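(* Let $U=P_2\odot C_1$ be the $6$-dimensional real linear space of functions on $\mathbb{R}$ generated by $\cos x,\ \sin x,\ x\cos x,\ x\sin x,\ x^2\cos x,\ x^2\sin x$. Then the critical length of $U$ equals $j_{\frac52,1}$, the first positive zero of the Bessel function $J_{\frac52}$.
   Context: A linear space $U$ of finite dimension consisting of (smooth) real functions on an interval $I$ is an extended Chebyshev space on $I$ if the number of zeros in $I$, counted with multiplicities, of any nonzero function of $U$ is less than $\dim U$. The critical length of a finite-dimensional translation-invariant space $U$ of differentiable functions on $\mathbb{R}$ is the supremum of the lengths of the intervals on which (the restriction of) $U$ is an extended Chebyshev space. $J_\nu(x)=\sum_{k=0}^\infty \frac{(-1)^k}{\Gamma(k+1)\Gamma(k+\nu+1)}\left(\frac{x}{2}\right)^{2k+\nu}$ is the Bessel function of the first kind. *)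

(* Defs.v *)
From HB Require Import structures.
From mathcomp Require Import all_boot all_order all_algebra.
From mathcomp Require Import all_classical all_reals all_analysis.

Set Implicit Arguments.
Unset Strict Implicit.
Unset Printing Implicit Defensive.

Import Order.TTheory GRing.Theory Num.Theory.
Import numFieldNormedType.Exports.

Local Open Scope classical_set_scope.
Local Open Scope ring_scope.

Definition lincomb (R : realType) (n : nat) (b : n.-tuple (R -> R))
    (c : 'I_n -> R) : R -> R :=
  fun x => \sum_(i < n) c i * tnth b i x.

Definition lspan (R : realType) (n : nat) (b : n.-tuple (R -> R)) :
    set (R -> R) :=
  [set f | exists c : 'I_n -> R, f = lincomb b c].

(* A function on the interval I is represented by a function on R, up to
   agreement on I. *)
Definition eq_on (R : realType) (I : interval R) (f g : R -> R) : Prop :=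
  forall x, x \in I -> f x = g x.

(* The restrictions to I of the functions of U form a linear space of
   dimension n, with basis the restrictions of the functions b_i. *)
Definition dim_on (R : realType) (I : interval R) (U : set (R -> R))
    (n : nat) : Prop :=
  exists b : n.-tuple (R -> R),
    [/\ forall c, eq_on I (lincomb b c) (fun=> 0) -> forall i, c i = 0,
        forall f, U f -> exists c, eq_on I f (lincomb b c)
      & forall c, exists2 f, U f & eq_on I f (lincomb b c)].

(* The derivatives are those of f on R. At an endpoint of a nondegenerate
   interval I they agree with the one-sided derivatives of the restriction
   of f to I. *)
Definition smooth_on (R : realType) (I : interval R) (f : R -> R) : Prop :=
  forall (k : nat) (x : R), x \in I -> derivable (derive1n k f) x 1.

(* Multiplicity of x as a zero of f: 0 if f x != 0, and +oo if all the
   derivatives of f vanish at x. *)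
Definition zero_mult (R : realType) (f : R -> R) (x : R) : \bar R :=
  ereal_sup [set m%:R%:E | m in
    [set m : nat | forall k, (k < m)%N -> derive1n k f x = 0]].

Definition zero_count (R : realType) (I : interval R) (f : R -> R) : \bar R :=
  \esum_(x in [set` I]) zero_mult f x.

Definition ext_chebyshev (R : realType) (I : interval R) (U : set (R -> R)) :
    Prop :=
  exists n : nat,
    [/\ dim_on I U n,
        forall f, U f -> smooth_on I f
      & forall f, U f -> ~ eq_on I f (fun=> 0) ->
          (zero_count I f < n%:R%:E)%E].

(* Degenerate intervals (empty or reduced to a point) are excluded. *)
Definition critical_length (R : realType) (U : set (R -> R)) : \bar R :=
  ereal_sup [set lebesgue_measure ([set` I] : set R) | I in
    [set I : interval R |
      (0 < lebesgue_measure ([set` I] : set R))%E /\ ext_chebyshev I U]].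

(* Euler's integral, for s > 0. *)
Definition Gamma (R : realType) (s : R) : R :=
  Rintegral lebesgue_measure `]0, +oo[ (fun t : R => t `^ (s - 1) * expR (- t)).

(* Meaningful for x > 0 and nu > -1. *)
Definition besselJ (R : realType) (nu x : R) : R :=
  limn (series (fun k : nat =>
    (-1) ^+ k / (Gamma (k%:R + 1) * Gamma (k%:R + nu + 1))
      * (x / 2) `^ (2 * k%:R + nu))).

Definition first_pos_zero (R : realType) (f : R -> R) (j : R) : Prop :=
  [/\ 0 < j, f j = 0 & forall x, 0 < x -> x < j -> f x <> 0].

Definition P2C1 (R : realType) : set (R -> R) :=
  lspan [tuple (fun x : R => cos x); (fun x : R => sin x);
               (fun x : R => x * cos x); (fun x : R => x * sin x);
               (fun x : R => x ^+ 2 * cos x); (fun x : R => x ^+ 2 * sin x)].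

(* Main.v *)
(* The space U of the theorem is spanned by the function
   g(x) = (3 - x^2) sin x - 3 x cos x, which is J_{5/2}(x) x^{5/2} up to a
   constant factor, and its derivatives. As g has a zero of order 5 at 0 and
   vanishes at its first positive zero j, a translate of g has six zeros in
   any interval longer than j.

   On ]0, j[ the Wronskians g, W(g, g') and W(g, g', g'') do not vanish, so for
   f in U Rolle's theorem applied to successive quotients of Wronskians turns
   six zeros of f into five of W(g, f), four of W(g, g', f) and three of
   W(g, g', g'', f). The last function is a combination, with coefficients
   f(0), f'(0), f''(0), of the 2 x 2 minors W(g', g''), W(g, g''), W(g, g'),
   because the functions of U with a triple zero at 0 are spanned by g, g', g''.
   The Wronskian of W(g, g') with that combination is W(g, g', g'') times
   f(0) g' + f'(0) g, and that of g with the latter is f(0) W(g, g'). The same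
   three Wronskians therefore exhaust all six zeros and force f = 0. *)
Require Import Defs.
From mathcomp Require Import all_boot all_order all_algebra.
From mathcomp Require Import all_classical all_reals all_analysis.
From mathcomp Require Import finmap ring lra measurable_realfun.

Set Implicit Arguments.
Unset Strict Implicit.
Unset Printing Implicit Defensive.

Import Order.TTheory GRing.Theory Num.Theory.
Import numFieldNormedType.Exports.

Local Open Scope ring_scope.
Local Open Scope classical_set_scope.

Local Notation "f ^` ()" := (derive1 f) : ring_scope.

(** * Smooth functions, orders of vanishing, and Rolle's theorem for Wronskians *)

Section SmoothFunctions.
Variable R : realType.
Implicit Types (f g u w : R -> R) (x y a b : R) (s p r : seq R).

Lemma derive1_eq f f' : (forall x, is_derive x 1 f (f' x)) -> f^`() = f'.
Proof. by move=> df; apply/funext => x; rewrite derive1E; apply: derive_val. Qed.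

Lemma is_derive_derive1 f x : derivable f x 1 -> is_derive x 1 f (f^`() x).
Proof. by move=> /derivableP; rewrite derive1E. Qed.

Lemma derive1_add f g :
  (forall x, derivable f x 1) -> (forall x, derivable g x 1) ->
  (fun x => f x + g x)^`() = fun x => f^`() x + g^`() x.
Proof.
by move=> df dg; apply: derive1_eq => x; apply: is_deriveD;
  apply: is_derive_derive1.
Qed.

Lemma derive1_mul f g :
  (forall x, derivable f x 1) -> (forall x, derivable g x 1) ->
  (fun x => f x * g x)^`() = fun x => f^`() x * g x + f x * g^`() x.
Proof.
move=> df dg; apply: derive1_eq => x.
apply: (is_derive_eq (is_deriveM (is_derive_derive1 (df x))
                                 (is_derive_derive1 (dg x)))).
by rewrite /GRing.scale /= addrC; congr (_ + _); rewrite mulrC.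
Qed.

Definition derivable_upto n f :=
  forall k x, (k < n)%N -> derivable (derive1n k f) x 1.

(* An inductive type, so that [done] does not unfold it: its attempts at
   derivability goals are very slow. *)
Variant smooth f : Prop := Smooth of forall n, derivable_upto n f.

Lemma smooth_upto n f : smooth f -> derivable_upto n f.
Proof. by case=> sf; exact: sf. Qed.

Lemma derivable_upto0 f : derivable_upto 0 f.
Proof. by move=> k x /[!ltn0]. Qed.

Lemma derivable_uptoS n f : derivable_upto n.+1 f <->
  (forall x, derivable f x 1) /\ derivable_upto n f^`().
Proof.
split=> [df|[df df']].
  split=> [x|k x kn]; first exact: (df 0%N).
  by rewrite -derive1Sn; exact: df.
by move=> [|k] x kn; [exact: df | rewrite derive1Sn; exact: df'].
Qed.

Lemma derivable_uptoW n f : derivable_upto n.+1 f -> derivable_upto n f.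
Proof. by move=> df k x kn; apply: df; exact: ltnW. Qed.

Lemma derivable_uptoD n f g : derivable_upto n f -> derivable_upto n g ->
  derivable_upto n (fun x => f x + g x).
Proof.
elim: n f g => [|n IH] f g; first by move=> _ _; exact: derivable_upto0.
move=> /derivable_uptoS[df df'] /derivable_uptoS[dg dg'].
apply/derivable_uptoS; split=> [x|]; first exact: derivableD.
by rewrite (derive1_add df dg); exact: IH.
Qed.

Lemma derivable_uptoM n f g : derivable_upto n f -> derivable_upto n g ->
  derivable_upto n (fun x => f x * g x).
Proof.
elim: n f g => [|n IH] f g Df Dg; first exact: derivable_upto0.
have [df df'] := (derivable_uptoS n f).1 Df.
have [dg dg'] := (derivable_uptoS n g).1 Dg.
apply/derivable_uptoS; split=> [x|]; first exact: derivableM.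
rewrite (derive1_mul df dg).
apply: derivable_uptoD; apply: IH; first exact: df'.
- exact: derivable_uptoW.
- exact: derivable_uptoW.
- exact: dg'.
Qed.

Lemma smooth_derivable f x : smooth f -> derivable f x 1.
Proof. by move=> sf; exact: (@smooth_upto 1 f sf 0%N). Qed.

Lemma smooth_derive1 f : smooth f -> smooth f^`().
Proof.
by move=> sf; split=> n; have /derivable_uptoS[_] := @smooth_upto n.+1 f sf; exact.
Qed.

Lemma smoothD f g : smooth f -> smooth g -> smooth (fun x => f x + g x).
Proof. by move=> [sf] [sg]; split=> n; exact: derivable_uptoD. Qed.

Lemma smoothM f g : smooth f -> smooth g -> smooth (fun x => f x * g x).
Proof. by move=> [sf] [sg]; split=> n; exact: derivable_uptoM. Qed.

Lemma smooth_cst a : smooth (fun=> a).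
Proof.
split=> n; elim: n a => [|n IH] a; first exact: derivable_upto0.
apply/derivable_uptoS; split=> [x|]; first exact: derivable_cst.
rewrite (derive1_eq (fun x => is_derive_cst a x 1)); exact: (IH 0).
Qed.

Lemma smooth_id : smooth (fun x => x).
Proof.
split=> [[|n]]; first exact: derivable_upto0.
apply/derivable_uptoS; split=> [x|]; first exact: derivable_id.
rewrite (derive1_eq (fun x => is_derive_id x 1)).
exact: smooth_upto (smooth_cst 1).
Qed.

Lemma smoothN f : smooth f -> smooth (fun x => - f x).
Proof.
move=> sf; rewrite (_ : (fun _ => _) = fun x => (-1) * f x).
  by apply: smoothM; first exact: smooth_cst.
by apply/funext => x; rewrite mulN1r.
Qed.

Lemma smoothB f g : smooth f -> smooth g -> smooth (fun x => f x - g x).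
Proof. by move=> sf sg; apply: smoothD; last exact: smoothN. Qed.

Lemma derive1_sin : (@sin R)^`() = @cos R.
Proof. by apply: derive1_eq => x; exact: is_derive_sin. Qed.

Lemma derive1_cos : (@cos R)^`() = fun x => - sin x.
Proof. by apply: derive1_eq => x; exact: is_derive_cos. Qed.

Lemma smooth_sin_cos : smooth (@sin R) /\ smooth (@cos R).
Proof.
(* Each of the two is, up to sign, the derivative of the other, so a single induction treats
   both. *)
suff H n : derivable_upto n (@sin R) /\ derivable_upto n (@cos R).
  by split; split=> n; have [] := H n.
elim: n => [|n [IHs IHc]]; first by split; exact: derivable_upto0.
split; apply/derivable_uptoS; split.
- by move=> x; exact: derivable_sin.
- by rewrite derive1_sin; exact: IHc.
- by move=> x; exact: derivable_cos.
rewrite derive1_cos (_ : (fun _ => _) = fun x => (-1) * sin x); last first.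
  by apply/funext => x; rewrite mulN1r.
by apply: derivable_uptoM; first exact: smooth_upto (smooth_cst _).
Qed.

Definition wronskian w f x := w x * f^`() x - w^`() x * f x.

Lemma smooth_wronskian w f : smooth w -> smooth f -> smooth (wronskian w f).
Proof.
by move=> sw sf; apply: smoothB; apply: smoothM => //; exact: smooth_derive1.
Qed.

Definition vanish m f x := forall k, (k < m)%N -> derive1n k f x = 0.

Lemma vanishS m f x : vanish m.+1 f x <-> f x = 0 /\ vanish m f^`() x.
Proof.
split=> [H|[f0 H]].
  by split=> [|k km]; [exact: (H 0%N) | rewrite -derive1Sn; exact: H].
by case=> [//|k] km; rewrite derive1Sn; exact: H.
Qed.

Lemma vanishW m n f x : (m <= n)%N -> vanish n f x -> vanish m f x.
Proof. by move=> mn H k km; apply: H; exact: leq_trans mn. Qed.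

Lemma vanishD m f g x : smooth f -> smooth g -> vanish m f x -> vanish m g x ->
  vanish m (fun y => f y + g y) x.
Proof.
elim: m f g => [//|m IH] f g sf sg /vanishS[f0 Vf] /vanishS[g0 Vg].
apply/vanishS; split; first by rewrite f0 g0 addr0.
rewrite derive1_add; try by move=> ?; exact: smooth_derivable.
by apply: IH => //; exact: smooth_derive1.
Qed.

Lemma vanishM m f g x : smooth f -> smooth g -> vanish m f x ->
  vanish m (fun y => f y * g y) x.
Proof.
elim: m f g => [//|m IH] f g sf sg Vf; have /vanishS[f0 Vf'] := Vf.
apply/vanishS; split; first by rewrite f0 mul0r.
rewrite derive1_mul; try by move=> ?; exact: smooth_derivable.
have [sf' sg'] := (smooth_derive1 sf, smooth_derive1 sg).
apply: vanishD; try exact: smoothM; first exact: IH.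
by apply: IH => //; exact: vanishW Vf.
Qed.

(** Only the term [w * f'] costs an order of vanishing; multiplying by a smooth factor costs
    none. *)
Lemma vanish_wronskian m w f x : smooth w -> smooth f ->
  vanish m.+1 f x -> vanish m (wronskian w f) x.
Proof.
move=> sw sf Vf; have /vanishS[_ Vf'] := Vf.
have [sf' sw'] := (smooth_derive1 sf, smooth_derive1 sw).
rewrite (_ : wronskian w f = fun y => f^`() y * w y + f y * (- w^`() y)).
  apply: vanishD; try by [exact: smoothM | apply: smoothM => //; exact: smoothN].
    exact: vanishM.
  apply: vanishM => //; first exact: smoothN.
  exact: vanishW Vf.
by apply/funext => y; rewrite /wronskian mulrC mulrN [X in _ - X]mulrC.
Qed.

(** By induction on the order: [u * f' = (u * f)' - f * u'], where [f * u'] vanishes to order [m] by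
    the induction hypothesis. *)
Lemma vanish_cancel m u f x : smooth u -> smooth f -> u x != 0 ->
  vanish m (fun y => u y * f y) x -> vanish m f x.
Proof.
move=> su sf ux; elim: m f sf => [//|m IH] f sf /[dup] Vuf /vanishS[uf0 Vuf'].
have [sf' su'] := (smooth_derive1 sf, smooth_derive1 su).
have Vf : vanish m f x by apply: IH => //; exact: vanishW Vuf.
apply/vanishS; split; first by move/eqP: uf0; rewrite mulf_eq0 (negPf ux) => /eqP.
apply: IH => //.
rewrite (_ : (fun _ => _) = fun y => (fun y => u y * f y)^`() y +
                                     f y * (- u^`() y)).
  apply: vanishD => //; last 1 first.
  - by apply: vanishM => //; exact: smoothN.
  - by apply: smooth_derive1; exact: smoothM.
  - by apply: smoothM => //; exact: smoothN.
apply/funext => y; rewrite derive1_mul; try by move=> ?; exact: smooth_derivable.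
by rewrite mulrN [f y * _]mulrC addrAC subrr add0r.
Qed.

(* Rolle's theorem for [f / w]. *)
Lemma wronskian_rolle w f x y : smooth w -> smooth f -> x < y ->
  (forall z, x <= z <= y -> w z != 0) -> f x = 0 -> f y = 0 ->
  exists2 z, x < z < y & wronskian w f z = 0.
Proof.
move=> sw sf xy w0 fx fy.
have dq z : x <= z <= y -> is_derive z 1 (fun t => f t * (w t)^-1)
    (wronskian w f z / w z ^+ 2).
  move=> /w0 wz; have dw := is_derive_derive1 (smooth_derivable (x := z) sw).
  have df := is_derive_derive1 (smooth_derivable (x := z) sf).
  apply: (is_derive_eq (is_deriveM df (is_deriveV wz dw))).
  by rewrite /GRing.scale /= /wronskian; field.
have [|||z] := @Rolle R (fun t => f t * (w t)^-1) x y xy.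
- move=> z; rewrite in_itv /= => /andP[xz zy].
  by have [] := dq z; rewrite ?(ltW xz) ?(ltW zy).
- apply: derivable_within_continuous => z; rewrite in_itv /= => zI.
  by have [] := dq z zI.
- by rewrite fx fy !mul0r.
rewrite in_itv /= => /andP[xz zy] dz.
exists z; first by rewrite xz zy.
have zI : x <= z <= y by rewrite (ltW xz) (ltW zy).
have : wronskian w f z / w z ^+ 2 = 0.
  by have [_ <-] := dq z zI; have [_ ->] := dz.
by move/eqP; rewrite mulf_eq0 invr_eq0 expf_eq0 /= (negPf (w0 z zI)) orbF => /eqP.
Qed.

(** A multiset of zeros in ]a, b[: a point may be repeated at most as often as its multiplicity
    allows, so [size s] counts zeros with multiplicity. *)
Definition zero_list a b f s :=
  forall x, x \in s -> a < x < b /\ vanish (count_mem x s) f x.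

(** The new zeros avoid [x :: p], so they can later be added to the zeros that the Wronskian
    inherits from multiple zeros of [f]. The bound [x < z] serves the induction: it separates the
    zero found in the first gap from the later ones. *)
Lemma rolle_points a b w f x p : smooth w -> smooth f ->
  (forall z, a < z < b -> w z != 0) ->
  path <%R x p -> {in x :: p, forall z, a < z < b /\ f z = 0} ->
  exists r, [/\ size r = size p, uniq r, {in r, forall z, z \notin x :: p} &
    {in r, forall z, [/\ x < z, z < b & wronskian w f z = 0]}].
Proof.
move=> sw sf w0; elim: p x => [|y p IH] x /=; first by exists [::].
move=> /andP[xy yp] Z.
have [r [sr ur rp rZ]] := IH y yp (fun z zp => Z z (@mem_behead _ (x :: y :: p) z zp)).
have [/andP[ax xb] fx] := Z x (mem_head _ _).
have [/andP[ay yb] fy] : a < y < b /\ f y = 0 by apply: Z; rewrite !inE eqxx orbT.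
have [|z0 /andP[xz zy] Wz] := wronskian_rolle sw sf xy _ fx fy.
  by move=> z /andP[xz zy]; rewrite w0// (lt_le_trans ax xz) (le_lt_trans zy yb).
have ltp z : z \in y :: p -> y <= z.
  by rewrite inE => /predU1P[->//|zp]; have /allP/(_ z zp)/ltW := order_path_min lt_trans yp.
exists (z0 :: r); split=> [|||] /=.
- by rewrite sr.
- by rewrite ur andbT; apply/negP => /rZ[yz _ _]; rewrite ltNge (ltW zy) in yz.
- move=> z; rewrite inE => /predU1P[->|zr].
    rewrite inE (gt_eqF xz) /=; apply/negP => /ltp.
    by rewrite leNgt zy.
  rewrite inE negb_or rp// andbT.
  by have [yz _ _] := rZ z zr; rewrite gt_eqF// (lt_trans xy yz).
- move=> z; rewrite inE => /predU1P[->|zr].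
    by split => //; exact: lt_trans yb.
  by have [yz zb Wz0] := rZ z zr; split=> //; exact: lt_trans yz.
Qed.

End SmoothFunctions.

(** * Rolle's theorem for zeros counted with multiplicity *)

Lemma count_mem_flatten_nseq (T : eqType) (n : T -> nat) (t : seq T) x :
  uniq t ->
  count_mem x (flatten [seq nseq (n y) y | y <- t]) = if x \in t then n x else 0%N.
Proof.
elim: t => //= y t IH /andP[yt ut]; rewrite count_cat count_nseq IH// inE /=.
have [->|xy] := eqVneq x y; first by rewrite mul1n (negPf yt) addn0.
by rewrite mul0n.
Qed.

Section ZeroLists.
Variable R : realType.
Implicit Types (f g h u w : R -> R) (x y a b : R) (s p r : seq R).

(* The repeated zeros of [f], each with multiplicity decreased by one, and one
   zero between any two consecutive distinct zeros. *)
Lemma zero_list_wronskian a b w u f h s :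
  smooth w -> smooth u -> smooth f -> smooth h ->
  (forall x, a < x < b -> w x != 0) -> (forall x, a < x < b -> u x != 0) ->
  wronskian w f = (fun x => u x * h x) ->
  zero_list a b f s ->
  exists2 s', size s' = (size s).-1 & zero_list a b h s'.
Proof.
move=> sw su sf sh w0 u0 Wuh Z.
(* The factor [u] has no zero in ]a, b[, so cancelling it keeps all orders of vanishing. *)
suff [s' ss' Z'] : exists2 s', size s' = (size s).-1 &
    zero_list a b (wronskian w f) s'.
  exists s' => // x /Z'[xab]; rewrite Wuh => V; split=> //.
  by apply: vanish_cancel V => //; exact: u0.
have [->|s0] := eqVneq s [::]; first by exists [::].
pose t := sort <=%R (undup s).
have ts x : (x \in t) = (x \in s) by rewrite mem_sort mem_undup.
have st : sorted <%R t by rewrite sort_lt_sorted undup_uniq.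
have ut : uniq t by rewrite sort_uniq undup_uniq.
have tZ : {in t, forall z, a < z < b /\ f z = 0}.
  move=> z; rewrite ts => /[dup] zs /Z[zab V]; split => //; apply: (V 0%N).
  by rewrite -has_count has_pred1.
have cnt x : (0 < count_mem x s)%N = (x \in t) by rewrite -has_count has_pred1 ts.
pose d := flatten [seq nseq (count_mem x s).-1 x | x <- t].
have cd x : count_mem x d = (count_mem x s).-1.
  by rewrite count_mem_flatten_nseq// -cnt; case: (count_mem x s).
(* A zero of multiplicity m in [s] is counted m - 1 times in [d] and once in [t]. *)
have sd : (size d + size t)%N = size s.
  rewrite -size_cat; apply/perm_size/allP => x _ /=.
  rewrite count_cat cd (count_uniq_mem _ ut) -cnt.
  by case: (count_mem x s) => //= m; rewrite addn1.
have [y ys] : exists y, y \in s by case: (s) s0 => // y s1 _; exists y; exact: mem_head.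
case Et : t => [|x p]; first by move: ys; rewrite -ts Et.
have [||r [sr ur rp rZ]] := @rolle_points R a b w f x p sw sf w0.
- by move: st; rewrite Et.
- by rewrite -Et.
exists (r ++ d).
  by rewrite size_cat sr -sd Et /= addnS /= addnC.
rewrite -Et in rp => z; rewrite mem_cat count_cat cd.
have [zt _|zt] := boolP (z \in t).
  have -> : count_mem z r = 0%N.
    by apply/count_memPn; apply/negP => /rp; rewrite zt.
  have [zab V] : a < z < b /\ vanish (count_mem z s) f z by apply: Z; rewrite -ts.
  split=> //; apply: vanish_wronskian => //.
  by rewrite add0n prednK// cnt.
have cz : count_mem z s = 0%N by apply/count_memPn; rewrite -ts.
have -> : (z \in d) = false.
  by apply/negbTE; rewrite -has_pred1 has_count cd cz.
rewrite orbF cz addn0 (count_uniq_mem _ ur) => zr; rewrite zr.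
have [xz zb Wz] := rZ z zr.
have [/andP[ax _] _] := tZ x ltac:(by rewrite Et mem_head).
split; first by rewrite zb (lt_trans ax xz).
by case.
Qed.

End ZeroLists.

(** * The six-dimensional space and its Wronskian identities *)

Section QuadraticTrig.
Variable R : realType.
Implicit Types (f g h u w : R -> R) (x y a b : R) (s : seq R).

Definition qtrig a0 a1 a2 b0 b1 b2 x : R :=
  (a0 + a1 * x + a2 * x ^+ 2) * cos x + (b0 + b1 * x + b2 * x ^+ 2) * sin x.

Lemma smooth_quadratic a0 a1 a2 : smooth (fun x : R => a0 + a1 * x + a2 * x ^+ 2).
Proof.
do ![apply: smoothD | apply: smoothM | exact: smooth_cst | exact: smooth_id].
Qed.

Lemma smooth_qtrig a0 a1 a2 b0 b1 b2 : smooth (qtrig a0 a1 a2 b0 b1 b2).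
Proof.
have [ss sc] := smooth_sin_cos R.
by apply: smoothD; apply: smoothM => //; exact: smooth_quadratic.
Qed.

Lemma derive1_quadratic a0 a1 a2 :
  (fun x : R => a0 + a1 * x + a2 * x ^+ 2)^`() = fun x => a1 + 2 * a2 * x.
Proof.
apply: derive1_eq => x.
have dc a : is_derive x 1 (fun=> a : R) 0 by exact: is_derive_cst.
have di : is_derive x 1 (fun y : R => y) 1 by exact: is_derive_id.
apply: (is_derive_eq (is_deriveD (is_deriveD (dc a0) (is_deriveM (dc a1) di))
  (is_deriveM (dc a2) (is_deriveM di di)))).
by rewrite /GRing.scale /=; ring.
Qed.

Lemma derive1_qtrig a0 a1 a2 b0 b1 b2 :
  (qtrig a0 a1 a2 b0 b1 b2)^`() =
  qtrig (a1 + b0) (2 * a2 + b1) b2 (b1 - a0) (2 * b2 - a1) (- a2).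
Proof.
have [ss sc] := smooth_sin_cos R.
rewrite derive1_add; try by move=> x; apply: smooth_derivable;
  apply: smoothM => //; exact: smooth_quadratic.
rewrite !derive1_mul; try by move=> x; apply: smooth_derivable => //; exact: smooth_quadratic.
rewrite !derive1_quadratic derive1_sin derive1_cos.
by apply/funext => x; rewrite /qtrig; ring.
Qed.

Lemma eq_qtrig a0 a1 a2 b0 b1 b2 a0' a1' a2' b0' b1' b2' :
  a0 = a0' -> a1 = a1' -> a2 = a2' -> b0 = b0' -> b1 = b1' -> b2 = b2' ->
  qtrig a0 a1 a2 b0 b1 b2 = qtrig a0' a1' a2' b0' b1' b2'.
Proof. by move=> -> -> -> -> -> ->. Qed.

(* Up to the factor [x ^ (5 / 2)] and a constant, [g0] is the Bessel function
   of order 5/2, and [g1], ..., [g4] are its successive derivatives. *)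
Definition g0 := qtrig 0 (- 3) 0 3 0 (- 1).
Definition g1 := qtrig 0 0 (- 1) 0 1 0.
Definition g2 := qtrig 0 (- 1) 0 1 0 1.
Definition g3 := qtrig 0 0 1 0 3 0.
Definition g4 := qtrig 0 5 0 3 0 (- 1).

Definition g5 := qtrig 8 0 (- 1) 0 (- 7) 0.

Lemma derive1_g0 : g0^`() = g1.
Proof. by rewrite derive1_qtrig; apply: eq_qtrig; ring. Qed.

Lemma derive1_g1 : g1^`() = g2.
Proof. by rewrite derive1_qtrig; apply: eq_qtrig; ring. Qed.

Lemma derive1_g2 : g2^`() = g3.
Proof. by rewrite derive1_qtrig; apply: eq_qtrig; ring. Qed.

Lemma derive1_g3 : g3^`() = g4.
Proof. by rewrite derive1_qtrig; apply: eq_qtrig; ring. Qed.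

Lemma derive1_g4 : g4^`() = g5.
Proof. by rewrite derive1_qtrig; apply: eq_qtrig; ring. Qed.

Lemma wronskianE w f dw df : w^`() = dw -> f^`() = df ->
  wronskian w f = fun x => w x * df x - dw x * f x.
Proof. by move=> <- <-. Qed.

Lemma derive1_wronskian w f : smooth w -> smooth f ->
  (wronskian w f)^`() = fun x => w x * f^`()^`() x - w^`()^`() x * f x.
Proof.
move=> sw sf; have [sw' sf'] := (smooth_derive1 sw, smooth_derive1 sf).
rewrite (_ : wronskian w f = fun x => w x * f^`() x + w^`() x * (- 1 * f x)).
  rewrite derive1_add; try by move=> x; apply: smooth_derivable;
    do ?[apply: smoothM => //]; exact: smooth_cst.
  have sN : smooth (fun x => - 1 * f x) by apply: smoothM => //; exact: smooth_cst.
  rewrite !derive1_mul; try by move=> x; apply: smooth_derivable => //; exact: smooth_cst.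
  apply/funext => x.
  rewrite (derive1_eq (fun x => is_derive_cst (- 1 : R) x 1)) /=.
  move: (w x) (f x) (w^`() x) (f^`() x) (w^`()^`() x) (f^`()^`() x).
  by move=> *; ring.
by apply/funext => x; rewrite /wronskian; ring.
Qed.

(** The 2 x 2 minors of the matrix with rows [g0, g1, g2] and [g1, g2, g3], indexed by their
    columns. *)
Definition m01 := wronskian g0 g1.
Definition m02 := wronskian g0 g2.
Definition m12 := wronskian g1 g2.

Lemma smooth_g0 : smooth g0. Proof. exact: smooth_qtrig. Qed.
Lemma smooth_g1 : smooth g1. Proof. exact: smooth_qtrig. Qed.
Lemma smooth_g2 : smooth g2. Proof. exact: smooth_qtrig. Qed.

Lemma m01E x : m01 x = g0 x * g2 x - g1 x * g1 x.
Proof. by rewrite /m01 /wronskian derive1_g0 derive1_g1. Qed.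

Lemma m02E x : m02 x = g0 x * g3 x - g1 x * g2 x.
Proof. by rewrite /m02 /wronskian derive1_g0 derive1_g2. Qed.

Lemma m12E x : m12 x = g1 x * g3 x - g2 x * g2 x.
Proof. by rewrite /m12 /wronskian derive1_g1 derive1_g2. Qed.

Lemma smooth_m01 : smooth m01.
Proof. exact: smooth_wronskian smooth_g0 smooth_g1. Qed.

Lemma smooth_m02 : smooth m02.
Proof. exact: smooth_wronskian smooth_g0 smooth_g2. Qed.

Lemma smooth_m12 : smooth m12.
Proof. exact: smooth_wronskian smooth_g1 smooth_g2. Qed.

Lemma derive1_m01 : m01^`() = m02.
Proof.
rewrite derive1_wronskian; [|exact: smooth_g0|exact: smooth_g1].
by apply/funext => x; rewrite m02E derive1_g0 !derive1_g1 derive1_g2; ring.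
Qed.

Lemma derive1_m02 : m02^`() = fun x => g0 x * g4 x - g2 x * g2 x.
Proof.
rewrite derive1_wronskian; [|exact: smooth_g0|exact: smooth_g2].
by apply/funext => x; rewrite derive1_g0 derive1_g1 derive1_g2 derive1_g3.
Qed.

Lemma derive1_m12 : m12^`() = fun x => g1 x * g4 x - g3 x * g2 x.
Proof.
rewrite derive1_wronskian; [|exact: smooth_g1|exact: smooth_g2].
by apply/funext => x; rewrite derive1_g1 derive1_g2 derive1_g3.
Qed.

(* The Wronskian of [g0], [g1] and [f]. *)
Definition wronskian3 f x :=
  m12 x * f x - m02 x * f^`() x + m01 x * f^`()^`() x.

Lemma derive1_dot3 u0 u1 u2 f0 f1 f2 : smooth u0 -> smooth u1 -> smooth u2 ->
  smooth f0 -> smooth f1 -> smooth f2 ->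
  (fun x => u0 x * f0 x - u1 x * f1 x + u2 x * f2 x)^`() = fun x =>
    u0^`() x * f0 x + u0 x * f0^`() x - (u1^`() x * f1 x + u1 x * f1^`() x) +
    (u2^`() x * f2 x + u2 x * f2^`() x).
Proof.
move=> su0 su1 su2 sf0 sf1 sf2; apply: derive1_eq => x.
have d f : smooth f -> is_derive x 1 f (f^`() x).
  by move=> sf; exact/is_derive_derive1/smooth_derivable.
apply: (is_derive_eq (is_deriveD (is_deriveB (is_deriveM (d _ su0) (d _ sf0))
  (is_deriveM (d _ su1) (d _ sf1))) (is_deriveM (d _ su2) (d _ sf2)))).
rewrite /GRing.scale /=.
move: (u0 x) (u1 x) (u2 x) (u0^`() x) (u1^`() x) (u2^`() x).
move: (f0 x) (f1 x) (f2 x) (f0^`() x) (f1^`() x) (f2^`() x).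
by move=> *; ring.
Qed.

Lemma smooth_wronskian3 f : smooth f -> smooth (wronskian3 f).
Proof.
move=> sf; have sf' := smooth_derive1 sf; have sf'' := smooth_derive1 sf'.
have [[s01 s02] s12] := (smooth_m01, smooth_m02, smooth_m12).
by apply: smoothD; [apply: smoothB|]; apply: smoothM.
Qed.

(** The Wronskian of [g0], [g1], [g2], that is, the Hankel determinant of [g0], ..., [g4]. *)
Definition w3 := wronskian3 g2.

Lemma w3E x : w3 x = m12 x * g2 x - m02 x * g3 x + m01 x * g4 x.
Proof. by rewrite /w3 /wronskian3 derive1_g2 derive1_g3. Qed.

Lemma smooth_w3 : smooth w3.
Proof. exact: smooth_wronskian3 smooth_g2. Qed.

(** When a Wronskian determinant is differentiated row by row, only the term with the last row
    differentiated survives. *)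
Lemma derive1_wronskian3 f : smooth f -> (wronskian3 f)^`() = fun x =>
  (g1 x * g4 x - g3 x * g2 x) * f x +
  (m12 x - (g0 x * g4 x - g2 x * g2 x)) * f^`() x + m01 x * f^`()^`()^`() x.
Proof.
move=> sf; have sf' := smooth_derive1 sf; have sf'' := smooth_derive1 sf'.
have [[s01 s02] s12] := (smooth_m01, smooth_m02, smooth_m12).
rewrite derive1_dot3// derive1_m01 derive1_m02 derive1_m12; apply/funext => x.
move: (f x) (f^`() x) (f^`()^`() x) (f^`()^`()^`() x) (m01 x) (m02 x) (m12 x).
by move: (g0 x) (g1 x) (g2 x) (g3 x) (g4 x) => *; ring.
Qed.

Lemma derive1_w3 : w3^`() = fun x =>
  (g1 x * g4 x - g3 x * g2 x) * g2 x +
  (m12 x - (g0 x * g4 x - g2 x * g2 x)) * g3 x + m01 x * g5 x.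
Proof.
rewrite (derive1_wronskian3 smooth_g2).
by rewrite derive1_g2 derive1_g3 derive1_g4.
Qed.

(** An instance of Sylvester's determinant identity. The factor [g0] can be cancelled where it does
    not vanish, so Rolle's theorem leads from [wronskian g0 f] to [wronskian3 f]. *)
Lemma wronskian_m01_wronskian f : smooth f ->
  wronskian m01 (wronskian g0 f) = fun x => g0 x * wronskian3 f x.
Proof.
move=> sf; apply/funext => x.
rewrite {1}/wronskian derive1_m01 derive1_wronskian//; last exact: smooth_g0.
rewrite /wronskian /wronskian3 derive1_g0 derive1_g1 m01E m02E m12E.
move: (f x) (f^`() x) (f^`()^`() x) (g0 x) (g1 x) (g2 x) (g3 x) => *; ring.
Qed.

(* The coefficients are the values at 0 of [f = qtrig a0 a1 a2 b0 b1 b2] and of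
   its first two derivatives. *)
Definition f3 a0 a1 a2 b0 b1 x :=
  a0 * m12 x - (- (a1 + b0)) * m02 x + (2 * (a2 + b1) - a0) * m01 x.

Definition f4 a0 a1 b0 x := a0 * g1 x + (a1 + b0) * g0 x.

(** By Sylvester's identity the left side is [m01] times the Wronskian of [g0], [g1], [g2], f. The
    latter depends on f only modulo the span of [g0], [g1], [g2], hence only on the values of f, f',
    f'' at 0, and it equals [- 8] times [f3]. *)
Lemma wronskian_w3_wronskian3 a0 a1 a2 b0 b1 b2 :
  wronskian w3 (wronskian3 (qtrig a0 a1 a2 b0 b1 b2)) =
  fun x => - 8 * m01 x * f3 a0 a1 a2 b0 b1 x.
Proof.
rewrite (wronskianE derive1_w3
  (derive1_wronskian3 (smooth_qtrig a0 a1 a2 b0 b1 b2))).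
apply/funext => x.
rewrite w3E /wronskian3 /f3 m01E m02E m12E.
rewrite !(derive1_qtrig, derive1_qtrig (_ + _)).
rewrite /g0 /g1 /g2 /g3 /g4 /g5 /qtrig.
have : cos x ^+ 2 = 1 - sin x ^+ 2 by rewrite cos2sin2.
move: (cos x) (sin x) => c s Hc.
by ring: Hc.
Qed.

(** By Sylvester's identity, the Wronskians of [m01] with [m02] and [m12] are [g0 * w3] and
    [g1 * w3]; the [m01] term of [f3] drops out. *)
Lemma wronskian_m01_f3 a0 a1 a2 b0 b1 :
  wronskian m01 (f3 a0 a1 a2 b0 b1) = fun x => w3 x * f4 a0 a1 b0 x.
Proof.
rewrite /wronskian derive1_m01 /f3.
rewrite (derive1_dot3 (smooth_cst _) (smooth_cst _) (smooth_cst _)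
  smooth_m12 smooth_m02 smooth_m01).
rewrite derive1_m01 derive1_m02 derive1_m12; apply/funext => x.
have dc (c : R) : (fun=> c)^`() = fun=> 0 :> R.
  exact: derive1_eq (fun x => is_derive_cst (c : R) x 1).
rewrite !dc w3E m01E m02E m12E /f4.
by move: (g0 x) (g1 x) (g2 x) (g3 x) (g4 x) => *; ring.
Qed.

Lemma wronskian_g0_f4 a0 a1 b0 :
  wronskian g0 (f4 a0 a1 b0) = fun x => m01 x * a0.
Proof.
have dc (c : R) : (fun=> c)^`() = fun=> 0 :> R.
  exact: derive1_eq (fun x => is_derive_cst (c : R) x 1).
apply/funext => x; rewrite /wronskian /f4 derive1_add; first last.
- by move=> y; apply: smooth_derivable; apply: smoothM; [exact: smooth_cst|exact: smooth_g0].
- by move=> y; apply: smooth_derivable; apply: smoothM; [exact: smooth_cst|exact: smooth_g1].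
rewrite !derive1_mul; do ?[move=> y; apply: smooth_derivable;
  by [exact: smooth_cst|exact: smooth_g0|exact: smooth_g1]].
rewrite !dc derive1_g0 derive1_g1 m01E.
by move: (g0 x) (g1 x) (g2 x) => *; ring.
Qed.

Lemma smooth_f3 a0 a1 a2 b0 b1 : smooth (f3 a0 a1 a2 b0 b1).
Proof.
by apply: smoothD; [apply: smoothB|]; apply: smoothM; do ?[exact: smooth_cst];
  [exact: smooth_m12|exact: smooth_m02|exact: smooth_m01].
Qed.

Lemma smooth_f4 a0 a1 b0 : smooth (f4 a0 a1 b0).
Proof.
by apply: smoothD; apply: smoothM; do ?[exact: smooth_cst];
  [exact: smooth_g1|exact: smooth_g0].
Qed.

(* These are the functions of the span that have a triple zero at 0. *)
Lemma qtrig_span a1 a2 b2 x : let p := - (a1 + b2) / 4 in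
  qtrig 0 a1 a2 (- a1) (- a2) b2 x =
  p * g0 x + (- a2) * g1 x + (b2 + p) * g2 x.
Proof. by rewrite /= /g0 /g1 /g2 /qtrig; field. Qed.

(** In the combination of [qtrig_span], the Wronskian with [g0] kills the [g0] term. Likewise
    [wronskian3] kills the [g0] and [g1] terms, which gives the next lemma. *)
Lemma wronskian_g0_span a1 a2 b2 x : let p := - (a1 + b2) / 4 in
  wronskian g0 (qtrig 0 a1 a2 (- a1) (- a2) b2) x =
  (- a2) * m01 x + (b2 + p) * m02 x.
Proof.
rewrite /= (wronskianE derive1_g0 (derive1_qtrig _ _ _ _ _ _)) m01E m02E.
rewrite /g0 /g1 /g2 /g3 /qtrig.
have : cos x ^+ 2 = 1 - sin x ^+ 2 by rewrite cos2sin2.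
by move: (cos x) (sin x) => c s Hc; field: Hc.
Qed.

Lemma wronskian3_span a1 a2 b2 x : let p := - (a1 + b2) / 4 in
  wronskian3 (qtrig 0 a1 a2 (- a1) (- a2) b2) x = (b2 + p) * w3 x.
Proof.
rewrite /= /wronskian3 !derive1_qtrig w3E m01E m02E m12E.
rewrite /g0 /g1 /g2 /g3 /g4 /qtrig.
have : cos x ^+ 2 = 1 - sin x ^+ 2 by rewrite cos2sin2.
by move: (cos x) (sin x) => c s Hc; field: Hc.
Qed.

Lemma zero_list_value a b f s : (0 < size s)%N -> zero_list a b f s ->
  exists2 x, a < x < b & f x = 0.
Proof.
case: s => // x s _ /(_ x (mem_head _ _))[xab V].
by exists x => //; apply: (V 0%N); rewrite /= eqxx.
Qed.

(** Five Rolle steps cost five zeros, so each function on the way down, including the final constant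
    [a0], still has a zero. On the way back up, each of these zeros yields one linear relation
    between the coefficients. *)
Lemma zero_list_qtrig a b a0 a1 a2 b0 b1 b2 s :
  (forall x, a < x < b -> g0 x != 0) -> (forall x, a < x < b -> m01 x != 0) ->
  (forall x, a < x < b -> w3 x != 0) -> (6 <= size s)%N ->
  zero_list a b (qtrig a0 a1 a2 b0 b1 b2) s ->
  [/\ a0 = 0, a1 = 0, a2 = 0 & [/\ b0 = 0, b1 = 0 & b2 = 0]].
Proof.
move=> G0 M0 W0 s6 Z0.
have [[sg0 sm01] sw3] := (smooth_g0, smooth_m01, smooth_w3).
have sF := smooth_qtrig a0 a1 a2 b0 b1 b2.
set F := qtrig _ _ _ _ _ _ in sF Z0.
have [sF1 sF2] := (smooth_wronskian sg0 sF, smooth_wronskian3 sF).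
have sF3 := smooth_f3 a0 a1 a2 b0 b1; have sF4 := smooth_f4 a0 a1 b0.
have [s1 ss1 Z1] : exists2 s1, size s1 = (size s).-1 & zero_list a b (wronskian g0 F) s1.
  (* The first Wronskian has no factor to cancel, hence [u] is the constant 1. *)
  apply: (zero_list_wronskian sg0 (smooth_cst 1) sF sF1 G0 _ _ Z0) => [x _|].
    exact: oner_neq0.
  by apply/funext => x; rewrite mul1r.
have [s2 ss2 Z2] : exists2 s2, size s2 = (size s1).-1 & zero_list a b (wronskian3 F) s2.
  by apply: (zero_list_wronskian sm01 sg0 sF1 sF2 M0 G0 _ Z1); exact: wronskian_m01_wronskian.
have [s3 ss3 Z3] : exists2 s3, size s3 = (size s2).-1 &
    zero_list a b (f3 a0 a1 a2 b0 b1) s3.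
  apply: (zero_list_wronskian sw3 (smoothM (smooth_cst (- 8)) sm01) sF2 sF3 W0 _ _ Z2).
    by move=> x /M0 mx; rewrite mulf_neq0// oppr_eq0 pnatr_eq0.
  exact: wronskian_w3_wronskian3.
have [s4 ss4 Z4] : exists2 s4, size s4 = (size s3).-1 & zero_list a b (f4 a0 a1 b0) s4.
  by apply: (zero_list_wronskian sm01 sw3 sF3 sF4 M0 W0 _ Z3); exact: wronskian_m01_f3.
have [s5 ss5 Z5] : exists2 s5, size s5 = (size s4).-1 & zero_list a b (fun=> a0) s5.
  by apply: (zero_list_wronskian sg0 sm01 sF4 (smooth_cst a0) G0 M0 _ Z4); exact: wronskian_g0_f4.
have p0 : (0 < size s)%N by exact: leq_trans s6.
have [p1 p2 p3 p4 p5] : [/\ 0 < size s1, 0 < size s2, 0 < size s3,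
    0 < size s4 & 0 < size s5]%N.
  by rewrite ss5 ss4 ss3 ss2 ss1; case: (size s) s6 => [|[|[|[|[|[|n]]]]]].
have [x0 _ a00] := zero_list_value p5 Z5.
(* From here the lists are used in reverse order: the relations already found reduce each function
   to a scalar times [g0], [m01] or [w3], and its zero forces the scalar to be 0. *)
have Eb0 : b0 = - a1.
  have [x /G0 gx] := zero_list_value p4 Z4.
  rewrite /f4 a00 mul0r add0r => /eqP.
  by rewrite mulf_eq0 (negPf gx) orbF addrC addr_eq0 => /eqP.
have Eb1 : b1 = - a2.
  have [x /M0 mx] := zero_list_value p3 Z3.
  rewrite /f3 a00 Eb0 subrr oppr0 !mul0r !subr0 add0r addr0 => /eqP.
  by rewrite mulf_eq0 (negPf mx) orbF mulf_eq0 pnatr_eq0/= addrC addr_eq0 => /eqP.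
rewrite /F a00 Eb0 Eb1 in Z0 Z1 Z2.
set p := - (a1 + b2) / 4.
have Ed : b2 + p = 0.
  have [x /W0 wx] := zero_list_value p2 Z2.
  by rewrite wronskian3_span => /eqP; rewrite mulf_eq0 (negPf wx) orbF => /eqP.
have Ea2 : a2 = 0.
  have [x /M0 mx] := zero_list_value p1 Z1.
  rewrite wronskian_g0_span Ed mul0r addr0 => /eqP.
  by rewrite mulf_eq0 (negPf mx) orbF oppr_eq0 => /eqP.
have Ep : p = 0.
  have [x /G0 gx] := zero_list_value p0 Z0.
  rewrite qtrig_span Ea2 -/p Ed oppr0 !mul0r !addr0 => /eqP.
  by rewrite mulf_eq0 (negPf gx) orbF => /eqP.
have Eb2 : b2 = 0 by move: Ed; rewrite Ep addr0.
have Ea1 : a1 = 0.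
  by move/eqP: Ep; rewrite /p Eb2 addr0 mulf_eq0 invr_eq0 pnatr_eq0 orbF oppr_eq0 => /eqP.
by split => //; split; rewrite ?Eb0 ?Eb1 ?Ea1 ?Ea2 ?oppr0.
Qed.

End QuadraticTrig.

(** * Signs of the three Wronskians up to the first zero of [g0] *)

Section Positivity.
Variable R : realType.
Implicit Types (f : R -> R) (x y z t a b : R).

Lemma derive_gt0_lt f f' a b : (forall x, is_derive x 1 f (f' x)) -> a < b ->
  (forall x, a < x < b -> 0 < f' x) -> f a < f b.
Proof.
move=> df ab f'0; rewrite -subr_gt0.
have [|x] := @MVT R f f' a b ab (fun x _ => df x).
  by apply: derivable_within_continuous => x _; have [] := df x.
by rewrite in_itv /= => /f'0 fx0 ->; rewrite mulr_gt0// subr_gt0.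
Qed.

Lemma derive_ge0_le f f' a b : (forall x, is_derive x 1 f (f' x)) -> a < b ->
  (forall x, a < x < b -> 0 <= f' x) -> f a <= f b.
Proof.
move=> df ab f'0; rewrite -subr_ge0.
have [|x] := @MVT R f f' a b ab (fun x _ => df x).
  by apply: derivable_within_continuous => x _; have [] := df x.
by rewrite in_itv /= => /f'0 fx0 ->; rewrite mulr_ge0// subr_ge0 ltW.
Qed.

Lemma derivableT_continuous f f' : (forall x, is_derive x 1 f (f' x)) -> continuous f.
Proof.
by move=> df x; apply/differentiable_continuous/derivable1_diffP; have [] := df x.
Qed.

Lemma ivt_zero f a b : continuous f -> a <= b -> f a * f b <= 0 ->
  exists2 z, a <= z <= b & f z = 0.
Proof.
move=> cf ab fab; have [||z] := @IVT R f a b 0 ab; last by rewrite in_itv; exists z.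
  exact: continuous_subspaceT.
by case: (leP (f a) (f b)) => ?; apply/andP; split; nra.
Qed.

Lemma is_derive_add f g x df dg : is_derive x 1 f df -> is_derive x 1 g dg ->
  is_derive x 1 (fun y => f y + g y) (df + dg).
Proof. exact: is_deriveD. Qed.

Lemma is_derive_opp f x df : is_derive x 1 f df ->
  is_derive x 1 (fun y => - f y) (- df).
Proof. exact: is_deriveN. Qed.

Lemma is_derive_mul f g x df dg : is_derive x 1 f df -> is_derive x 1 g dg ->
  is_derive x 1 (fun y => f y * g y) (df * g x + f x * dg).
Proof.
move=> Hf Hg; apply: (is_derive_eq (is_deriveM Hf Hg)).
by rewrite /GRing.scale /= addrC; congr (_ + _); rewrite mulrC.
Qed.

Lemma is_derive_const a x : is_derive x 1 (fun=> a) 0.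
Proof. exact: is_derive_cst. Qed.

Lemma is_derive_var x : is_derive x 1 (fun y => y) 1.
Proof. exact: is_derive_id. Qed.

Ltac derive_tac := notypeclasses refine (is_derive_eq _ _); [
  repeat first [ apply is_derive_const | apply is_derive_var
  | apply is_derive_sin | apply is_derive_cos
  | notypeclasses refine (is_derive_add _ _)
  | notypeclasses refine (is_derive_opp _)
  | notypeclasses refine (is_derive_mul _ _) ] | rewrite /= ].

Lemma is_derive_qtrig a0 a1 a2 b0 b1 b2 x :
  is_derive x 1 (@qtrig R a0 a1 a2 b0 b1 b2)
    (qtrig (a1 + b0) (2 * a2 + b1) b2 (b1 - a0) (2 * b2 - a1) (- a2) x).
Proof.
rewrite -derive1_qtrig; apply: is_derive_derive1.
exact/smooth_derivable/smooth_qtrig.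
Qed.

(** Up to a constant factor, [x ^ (3 / 2)] times the Bessel function of order 3/2; the derivative of
    [g0] is [x * h x]. *)
Let h x := sin x - x * cos x.

Let dh x : is_derive x 1 h (x * sin x).
Proof. by rewrite /h; derive_tac; ring. Qed.

Let h0 : h 0 = 0. Proof. by rewrite /h sin0 mul0r subr0. Qed.

Lemma sin_gt_xcos x : 0 < x <= pi -> x * cos x < sin x.
Proof.
move=> /andP[x0 xpi]; rewrite -subr_gt0 -[sin x - _]/(h x) -h0.
apply: derive_gt0_lt dh x0 _ => y /andP[y0 yx].
by rewrite mulr_gt0// sin_gt0_pi// y0 (lt_le_trans yx xpi).
Qed.

Lemma sin_le_id x : 0 < x -> sin x <= x.
Proof.
move=> x0; rewrite -subr_ge0.
have -> : 0 = 0 - sin 0 :> R by rewrite sin0 subr0.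
apply: (@derive_ge0_le (fun y => y - sin y) (fun y => 1 - cos y)) => //.
Qed.

(** From cos (pi / 2) = 0 the square of sin (pi / 4) is 1/2, and sin (pi / 4) is at most pi / 4. *)
Lemma pihalf_sqr_ge2 : 2 <= (pi / 2 : R) ^+ 2.
Proof.
have p0 := @pi_gt0 R.
have := cos_pihalf R; have -> : (pi / 2 : R) = pi / 4 + pi / 4 by field.
rewrite cosD -!expr2 cos2sin2.
have := @sin_le_id (pi / 4) ltac:(by lra).
have : 0 < sin (pi / 4 : R) by apply: sin_gt0_pihalf; lra.
move: (sin _) => s; nra.
Qed.

(** The function [h] increases from 0 on [0, pi], then decreases from pi to - 2 pi on [pi, 2 pi], so
    it changes sign once, at some [z]. Hence [g0] increases from 0 up to [z] and then decreases to
    the negative value - 6 pi at 2 pi. *)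
Lemma g0_first_zero : exists j : R,
  [/\ 0 < j, j < pi *+ 2, g0 j = 0 & forall x, 0 < x < j -> 0 < g0 x].
Proof.
have p0 := @pi_gt0 R.
have dg0 x : is_derive x 1 (@g0 R) (x * h x).
  by apply: is_derive_eq (is_derive_qtrig _ _ _ _ _ _ x) _; rewrite /qtrig /h; ring.
have g00 : g0 0 = 0 :> R by rewrite /g0 /qtrig sin0; ring.
have ch := derivableT_continuous dh; have cg := derivableT_continuous dg0.
have hpi : h pi = pi by rewrite /h sinpi cospi; ring.
have h2pi : h (pi *+ 2) = - (pi *+ 2) by rewrite /h sin2pi cos2pi; ring.
have g2pi : g0 (pi *+ 2) = - 6 * pi :> R by rewrite /g0 /qtrig sin2pi cos2pi; ring.
have [||z /andP[pz z2p] hz] := @ivt_zero h pi (pi *+ 2) ch.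
- lra.
- rewrite hpi h2pi; nra.
have {}pz : pi < z.
  by rewrite lt_neqAle pz andbT; apply/eqP => E; move: hz; rewrite -E hpi; lra.
have {}z2p : z < pi *+ 2.
  by rewrite lt_neqAle z2p andbT; apply/eqP => E; move: hz; rewrite E h2pi; lra.
have sinneg y : pi < y < pi *+ 2 -> 0 < - sin y.
  move=> /andP[py y2p]; have := @sin_gt0_pi R (y - pi).
  rewrite -[in X in _ -> X](subrK pi y) sinDpi opprK; apply.
  by apply/andP; split; lra.
have dNh x : is_derive x 1 (fun y => - h y) (x * - sin x).
  by apply: is_derive_eq (is_derive_opp (dh x)) _; ring.
have hpos x : 0 < x < z -> 0 < h x.
  move=> /andP[x0 xz]; have [xp|px] := leP x pi.
    by rewrite subr_gt0 sin_gt_xcos// x0.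
  suff : - h x < - h z by rewrite hz; lra.
  apply: derive_gt0_lt dNh xz _ => y /andP[xy yz].
  by rewrite mulr_gt0 ?sinneg//; [lra | apply/andP; split; lra].
have hneg x : z < x < pi *+ 2 -> 0 < - h x.
  move=> /andP[zx x2p]; suff : - h z < - h x by rewrite hz; lra.
  apply: derive_gt0_lt dNh zx _ => y /andP[zy yx].
  by rewrite mulr_gt0 ?sinneg//; [lra | apply/andP; split; lra].
have gpos x : 0 < x <= z -> 0 < g0 x.
  move=> /andP[x0 xz]; rewrite -g00; apply: derive_gt0_lt dg0 x0 _ => y /andP[y0 yx].
  by rewrite mulr_gt0// hpos// y0 (lt_le_trans yx).
have [||j /andP[zj j2p] gj] := @ivt_zero (@g0 R) z (pi *+ 2) cg.
- exact: ltW.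
- have := gpos z; rewrite g2pi => /(_ ltac:(apply/andP; split; lra)); nra.
exists j; split => //.
- by lra.
- by rewrite lt_neqAle j2p andbT; apply/eqP => E; move: gj; rewrite E g2pi; lra.
move=> x /andP[x0 xj]; have [xz|zx] := leP x z; first by rewrite gpos// x0.
suff : - g0 x < - g0 j by rewrite gj; lra.
apply: (@derive_gt0_lt (fun y => - g0 y) (fun y => y * - h y)) => // y.
  by apply: is_derive_eq (is_derive_opp (dg0 y)) _; ring.
by move=> /andP[xy yj]; rewrite mulr_gt0 ?hneg//; [lra | apply/andP; split; lra].
Qed.

(** The derivative of [m01] is [- 4 * x * q x]. *)
Let q x := x * x - 2 * (sin x * sin x) + x * (sin x * cos x).
Let q1 x := 2 * x - 3 * (sin x * cos x) + x * (cos x * cos x - sin x * sin x).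

Let dq x : is_derive x 1 q (q1 x).
Proof. by rewrite /q; derive_tac; rewrite /q1; ring. Qed.

Let dq1 x : is_derive x 1 q1 (4 * sin x * h x).
Proof.
rewrite /q1; derive_tac; rewrite /h.
have : cos x ^+ 2 = 1 - sin x ^+ 2 by rewrite cos2sin2.
by move: (cos x) (sin x) => c s Hc; ring: Hc.
Qed.

(** Up to pi, integrate twice from 0: the second derivative [4 * sin x * h x] is positive. Beyond
    pi, [x * x] dominates, as [x > 2] and [sin x * cos x >= - 1 / 2]. *)
Let q_gt0 x : 0 < x -> 0 < q x.
Proof.
move=> x0; have [xp|px] := leP x pi; last first.
  have x2 : 2 < x by exact: le_lt_trans (@pi_ge2 R) px.
  have := cos2Dsin2 x; rewrite /q; move: (cos x) (sin x) => c s cs.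
  have sc : 0 <= 1 + 2 * (s * c) by rewrite -cs; have := sqr_ge0 (s + c); nra.
  nra.
have E : q 0 = 0 by rewrite /q sin0; ring.
rewrite -E; apply: derive_gt0_lt dq x0 _ => y /andP[y0 yx].
have E1 : q1 0 = 0 by rewrite /q1 sin0; ring.
rewrite -E1; apply: derive_gt0_lt dq1 y0 _ => t /andP[t0 ty].
rewrite !mulr_gt0//; first by apply: sin_gt0_pi; lra.
by rewrite subr_gt0 sin_gt_xcos//; lra.
Qed.

Lemma m01_lt0 x : 0 < x -> m01 x < 0.
Proof.
move=> x0; rewrite -oppr_gt0.
have E : - m01 0 = 0 :> R by rewrite m01E /g0 /g1 /g2 /qtrig sin0; ring.
rewrite -E.
have D y : is_derive y 1 (fun y => - m01 y) (4 * y * q y).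
  apply: is_derive_eq (is_derive_opp (is_derive_derive1 (smooth_derivable (smooth_m01 R)))) _.
  rewrite derive1_m01 m02E /g0 /g1 /g2 /g3 /qtrig /q.
  have : cos y ^+ 2 = 1 - sin y ^+ 2 by rewrite cos2sin2.
  by move: (cos y) (sin y) => c s Hc; ring: Hc.
apply: derive_gt0_lt D x0 _ => y /andP[y0 _].
by rewrite !mulr_gt0// q_gt0.
Qed.

(* [w3] at [2 * t] factors because the space splits into its even and its odd
   functions about the midpoint of [0] and [2 * t]. *)
Let wodd t := cos t * (sin t * sin t) + t * sin t - 2 * (t * t * cos t).
Let weven t := 2 * (t * t * sin t) + t * cos t - sin t * (cos t * cos t).

Let w3_double t : w3 (t + t) = - 64 * wodd t * weven t.
Proof.
rewrite w3E m01E m02E m12E /g0 /g1 /g2 /g3 /g4 /qtrig sinD cosD /wodd /weven.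
have : cos t ^+ 2 = 1 - sin t ^+ 2 by rewrite cos2sin2.
by move: (cos t) (sin t) => c s Hc; ring: Hc.
Qed.

(** The derivative is positive. This is immediate when the cosine is nonpositive; otherwise
    [3 * (x - sin x * cos x) <= 2 * x ^ 3] bounds it below by [2 * x ^ 2 * (sin x - x * cos x)]. *)
Let wodd_gt0 t : 0 < t < pi -> 0 < wodd t.
Proof.
move=> /andP[t0 tpi].
have E : wodd 0 = 0 by rewrite /wodd sin0; ring.
rewrite -E; apply: (@derive_gt0_lt wodd (fun t => 2 * (t * t) * sin t
    - 3 * cos t * (t - sin t * cos t))) => // x.
  rewrite /wodd; derive_tac.
  have : cos x ^+ 2 = 1 - sin x ^+ 2 by rewrite cos2sin2.
  by move: (cos x) (sin x) => c s Hc; ring: Hc.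
move=> /andP[x0 xt].
have s0 : 0 < sin x by apply: sin_gt0_pi; lra.
have hx := @sin_gt_xcos x ltac:(lra).
have [c0|c0] := leP (cos x) 0.
  have : 0 < x * x * sin x by rewrite !mulr_gt0.
  move: s0 c0 {hx}; move: (cos x) (sin x) => c s; nra.
have : 0 <= x * x * x * 2 - 3 * (x - sin x * cos x).
  have E1 : 0 * 0 * 0 * 2 - 3 * (0 - sin 0 * cos 0) = 0 :> R by rewrite sin0; ring.
  rewrite -E1.
  apply: (@derive_ge0_le (fun x => x * x * x * 2 - 3 * (x - sin x * cos x))
     (fun x => 6 * (x * x - sin x * sin x))) => // y.
    derive_tac.
    have : cos y ^+ 2 = 1 - sin y ^+ 2 by rewrite cos2sin2.
    by move: (cos y) (sin y) => c s Hc; ring: Hc.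
  move=> /andP[y0 yx]; have := sin_le_id y0.
  have : 0 < sin y by apply: sin_gt0_pi; lra.
  move: (sin y) => s; nra.
have xx : 0 < x * x by rewrite mulr_gt0.
move: s0 c0 hx; move: (cos x) (sin x) => c s s0 c0 hx H.
have : 0 <= c * (x * x * x * 2 - 3 * (x - s * c)) by rewrite mulr_ge0// ltW.
have : 0 < x * x * (s - x * c) by rewrite mulr_gt0// subr_gt0.
nra.
Qed.

(** Up to pi / 2 the derivative is a sum of positive terms. Beyond pi / 2, the positivity of [g0] at
    [2 * t] is what excludes a zero. *)
Let weven_gt0 t : 0 < t < pi -> 0 < g0 (t + t) -> 0 < weven t.
Proof.
move=> /andP[t0 tpi] G.
have s0 : 0 < sin t by apply: sin_gt0_pi; lra.
have [tp|tp] := leP t (pi / 2).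
  have E : weven 0 = 0 by rewrite /weven sin0; ring.
  rewrite -E; apply: (@derive_gt0_lt weven (fun t => 3 * (t * sin t) +
      2 * (t * t * cos t) + 3 * (sin t * sin t * cos t))) => // x.
    rewrite /weven; derive_tac.
    have : cos x ^+ 2 = 1 - sin x ^+ 2 by rewrite cos2sin2.
    by move: (cos x) (sin x) => c s Hc; ring: Hc.
  move=> /andP[x0 xt].
  have sx : 0 < sin x by apply: sin_gt0_pi; lra.
  have cx : 0 < cos x by apply: cos_gt0_pihalf; lra.
  by rewrite !addr_gt0// !mulr_gt0.
have c0 : cos t < 0.
  have p0 := @pi_gt0 R.
  by rewrite -(cos_pihalf R) ltr_cos// in_itv /=; lra.
have t2 : 2 < t * t.
  have p0 := @pi_gt0 R.
  by have := pihalf_sqr_ge2; nra.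
move: G; rewrite /g0 /qtrig sinD cosD /weven; have := cos2Dsin2 t.
have -> : cos t = - - cos t by rewrite opprK.
have {c0} : 0 < - cos t by rewrite oppr_gt0.
move: (- cos t) (sin t) s0 => b s s0 b0 bs G.
(* With b = - cos t and s = sin t, [weven t] is [2 * t ^ 2 * s - t * b - s * b ^ 2]. In the first
   case [t * b < 3 * s / 2] and [t ^ 2 > 2] suffice. *)
have [H|H] := ltP (2 * (t * b)) (3 * s).
  have b1 : b * b <= 1 by nra.
  have : 0 < s * (t * t - 2) by rewrite mulr_gt0// subr_gt0.
  have : 0 <= s * (1 - b * b) by apply: mulr_ge0; [exact: ltW | rewrite subr_ge0].
  nra.
(* In the second case, [b * weven t] is one third of the expression in [G'], plus one third of that
   in [H1], plus that in [H2]. *)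
rewrite -(pmulr_rgt0 _ b0).
have G' : 0 < (4 * (t * t) - 3) * s * b - 3 * t * (b * b - s * s) by lra.
have H1 : 0 <= (t * s) * (2 * (t * b) - 3 * s).
  by apply: mulr_ge0; [rewrite ltW// mulr_gt0 | rewrite subr_ge0].
have H2 : 0 <= s * b * (1 - b * b).
  by apply: mulr_ge0; [rewrite ltW// mulr_gt0 | nra].
lra.
Qed.

Lemma w3_neq0 x : 0 < x < pi *+ 2 -> 0 < g0 x -> w3 x != 0.
Proof.
move=> x2p gx; have E : x = x / 2 + x / 2 by field.
have x2 : 0 < x / 2 < pi by lra.
rewrite E w3_double; rewrite E in gx.
by rewrite !mulf_neq0 ?oppr_eq0 ?pnatr_eq0// gt_eqF// ?wodd_gt0// weven_gt0.
Qed.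

End Positivity.

(** * Zero counts as extended sums, and long intervals *)

Section ZeroCount.
Variable R : realType.
Implicit Types (f : R -> R) (x y a b c j : R) (s : seq R) (I : interval R).

Lemma zero_mult_ge m f x : vanish m f x -> (m%:R%:E <= zero_mult f x)%E.
Proof. by move=> V; apply: ereal_sup_ubound; exists m. Qed.

Lemma zero_mult_le m f x : ~ vanish m.+1 f x -> (zero_mult f x <= m%:R%:E)%E.
Proof.
move=> V; apply: ge_ereal_sup => _ [k /= Vk <-].
rewrite lee_fin ler_nat leqNgt; apply/negP => mk.
by apply: V; exact: vanishW Vk.
Qed.

(** Multiplicities are finite, since a zero of infinite order could be listed [n] times. Each finite
    partial sum of the count is then the size of a zero list, hence at most n - 1, a bound that
    passes to the supremum and keeps the inequality strict. *)
Lemma zero_list_ltn_zero_count n f a b :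
  (forall s, zero_list a b f s -> (size s < n)%N) ->
  (zero_count `]a, b[%R f < n%:R%:E)%E.
Proof.
move=> Zn.
have n0 : (0 < n)%N by exact: (Zn [::]).
have mult x : exists m, a < x < b -> vanish m f x /\ ~ vanish m.+1 f x.
  have [xab|] := boolP (a < x < b); last by exists 0%N.
  apply: contrapT => /forallNP N.
  have V m : vanish m f x.
    elim: m => [//|m IH]; apply: contrapT => NV; exact: (N m).
  suff : (size (nseq n x) < n)%N by rewrite size_nseq ltnn.
  apply: Zn.
  by move=> y; rewrite mem_nseq => /andP[_ /eqP->]; split.
have [mu Hmu] := choice mult.
apply: (@le_lt_trans _ _ (n.-1)%:R%:E); last by rewrite lte_fin ltr_nat prednK.
apply: ge_ereal_sup => _ [A [finA subA] <-].
rewrite fsbig_finite//=.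
pose r : seq R := finmap.enum_fset (fset_set A).
have inA x : x \in r -> a < x < b.
  by rewrite [_ \in r]in_fset_set// => /set_mem/subA; rewrite /= in_itv.
have ur : uniq r by exact: fset_uniq.
rewrite -[finmap.enum_fset _]/r; move: r inA ur => r inA ur.
apply: (@le_trans _ _ (\sum_(x <- r) (mu x)%:R%:E)).
  rewrite big_seq [leRHS]big_seq; apply: lee_sum => x xr.
  by have [_ NV] := Hmu x (inA x xr); exact: zero_mult_le.
rewrite sumEFin lee_fin -natr_sum ler_nat -ltnS prednK//.
have <- : size (flatten [seq nseq (mu x) x | x <- r]) = (\sum_(x <- r) mu x)%N.
  rewrite size_flatten sumnE !big_map.
  by apply: eq_bigr => x _; rewrite size_nseq.
apply: Zn => x xs.
have : (0 < count_mem x (flatten [seq nseq (mu x) x | x <- r]))%N.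
  by rewrite -has_count has_pred1.
rewrite count_mem_flatten_nseq//.
by case: ifPn => // /inA xab _; have [V _] := Hmu x xab.
Qed.

Lemma zero_count_ge2 m n I f x y : x != y -> x \in I -> y \in I ->
  vanish m f x -> vanish n f y -> ((m + n)%:R%:E <= zero_count I f)%E.
Proof.
move=> xy xI yI Vx Vy; apply: esum_ge; exists [set` [:: x; y]].
  split; first exact: finite_seq.
  by move=> z /=; rewrite !inE => /orP[] /eqP->.
rewrite -fsbig_seq/=; last by rewrite inE xy.
by rewrite !big_cons big_nil adde0 natrD EFinD leeD// zero_mult_ge.
Qed.

Lemma itv_convex I x y z : x \in I -> y \in I -> x <= z <= y -> z \in I.
Proof.
move=> xI yI xzy; exact: (@interval_is_interval _ I x y xI yI z xzy).
Qed.

(** The segment from [a] to [a + j] is placed strictly between the ends of [I], so it does not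
    matter whether [I] contains them. *)
Lemma long_itv I j : 0 < j ->
  (j%:E < lebesgue_measure ([set` I] : set R))%E ->
  exists2 a, a \in I & a + j \in I.
Proof.
move=> j0; rewrite lebesgue_measure_itv; case: ifPn => [_|_]; last first.
  by rewrite lte_fin ltNge (ltW j0).
have H (lo hi : itv_bound R) a : ((lo : \bar R) < a%:E -> a%:E < (hi : \bar R) ->
   a \in Interval lo hi)%E.
  case: lo => [p x|[]]; case: hi => [q y|[]] //=; rewrite ?lte_fin ?ltxx// in_itv/= => xa ay;
  by rewrite ?lteifS ?xa ?ay// ?ltNyr.
case: I => lo hi /= jI.
suff [a loa ahi] : exists2 a : R, (lo < a%:E)%E & ((a + j)%:E < hi)%E.
  exists a; apply: H => //.
    by apply: le_lt_trans ahi; rewrite lee_fin lerDl ltW.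
  by apply: lt_le_trans loa _; rewrite lee_fin lerDl ltW.
case: lo hi jI => [p x|[]] [q y|[]] //=; rewrite ?lte_fin.
- move=> jxy; exists (x + (y - x - j) / 2); rewrite lte_fin; lra.
- by move=> _; exists (x + 1); [rewrite lte_fin; lra | exact: ltry].
- by move=> _; exists (y - j - 1); [exact: ltNyr | rewrite lte_fin; lra].
- by move=> _; exists 0; [exact: ltNyr | exact: ltry].
Qed.

End ZeroCount.

(** * The critical length is the first zero of [g0] *)

Section CriticalLength.
Variable R : realType.
Implicit Types (f : R -> R) (x y a b c j : R) (I : interval R).

Let basis := [tuple (fun x : R => cos x); (fun x : R => sin x);
  (fun x : R => x * cos x); (fun x : R => x * sin x);
  (fun x : R => x ^+ 2 * cos x); (fun x : R => x ^+ 2 * sin x)].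

Lemma lincomb_qtrig (c : 'I_6 -> R) : lincomb basis c =
  qtrig (c (inord 0)) (c (inord 2)) (c (inord 4))
        (c (inord 1)) (c (inord 3)) (c (inord 5)).
Proof.
have E i : c i = c (inord i) by rewrite inord_val.
apply/funext => x; rewrite /lincomb; under eq_bigr => i _ do rewrite E.
rewrite !big_ord_recl big_ord0 !(tnth_nth 0) /= /bump !leq0n !add1n /qtrig.
by ring.
Qed.

Lemma P2C1_qtrig f : P2C1 f ->
  exists a0 a1 a2 b0 b1 b2, f = qtrig a0 a1 a2 b0 b1 b2.
Proof. by move=> [c ->]; rewrite lincomb_qtrig; do 6 eexists. Qed.

Lemma qtrig_P2C1 a0 a1 a2 b0 b1 b2 : P2C1 (@qtrig R a0 a1 a2 b0 b1 b2).
Proof.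
exists (fun i : 'I_6 => nth 0 [:: a0; b0; a1; b1; a2; b2] i).
by rewrite lincomb_qtrig !inordK.
Qed.

(** Write the basis functions in terms of [u]: a left kernel vector of the coordinate matrix is a
    linear relation on [I], so the [n] rows are independent. The bound is needed because
    [ext_chebyshev] leaves the dimension existential. *)
Lemma dim_on_le I m (u : m.-tuple (R -> R)) n :
  dim_on I (lspan u) n -> (n <= m)%N.
Proof.
move=> [b [bfree _ bspan]].
have coord i : exists d : 'I_m -> R, eq_on I (lincomb u d) (tnth b i).
  have [_ [d ->] fd] := bspan (fun k => (k == i)%:R).
  exists d => x xI; rewrite fd// /lincomb (bigD1 i)//= eqxx mul1r big1 ?addr0// => k.
  by move=> /negPf->; rewrite mul0r.
have [d Hd] := choice coord.
pose M := \matrix_(i < n, k < m) d i k.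
rewrite -(eqP (_ : row_free M)) ?rank_leq_col//.
rewrite -kermx_eq0; apply/eqP/row_matrixP => i; rewrite row0.
have kM : row i (kermx M) *m M = 0 by rewrite -row_mul mulmx_ker row0.
apply/rowP => k; rewrite [RHS]mxE.
apply: (bfree (fun k => row i (kermx M) 0 k)) => x xI.
rewrite /lincomb; under eq_bigr => l _ do rewrite -(Hd l x xI) /lincomb mulr_sumr.
rewrite exchange_big /= big1// => l _.
under eq_bigr => q _ do rewrite mulrA.
rewrite -mulr_suml.
have /rowP/(_ l) := kM; rewrite !mxE => kMl.
rewrite (_ : \sum_(_ < n) _ = 0) ?mul0r// -[RHS]kMl.
by apply: eq_bigr => q _; rewrite !mxE.
Qed.

Definition shift a f x := f (x - a).

Lemma derive1n_shift k a f : smooth f ->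
  derive1n k (shift a f) = shift a (derive1n k f).
Proof.
elim: k f => [//|k IH] f sf; rewrite !derive1Sn -IH; last exact: smooth_derive1.
congr (derive1n k _); apply: derive1_eq => x; rewrite /shift.
have df : is_derive (x - a) 1 f (f^`() (x - a)).
  exact/is_derive_derive1/smooth_derivable.
have ds : is_derive x 1 (fun y => y - a) 1.
  apply: (is_derive_eq (is_derive_add (is_derive_var x) (is_derive_const (- a) x))).
  by rewrite addr0.
apply: (is_derive_eq (@is_derive1_comp _ f (fun y => y - a) x _ _ df ds)).
by rewrite mulr1.
Qed.

Lemma vanish_shift m a f x : smooth f -> vanish m f x ->
  vanish m (shift a f) (x + a).
Proof. by move=> sf V k km; rewrite derive1n_shift// /shift addrK; exact: V. Qed.

Lemma vanish_g0 : vanish 5 (@g0 R) 0.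
Proof.
have v a1 a2 b0 b1 b2 : @qtrig R 0 a1 a2 b0 b1 b2 0 = 0.
  by rewrite /qtrig sin0 !(mulr0, expr0n, mul0r, addr0).
apply/vanishS; split; first exact: v.
rewrite derive1_g0; apply/vanishS; split; first exact: v.
rewrite derive1_g1; apply/vanishS; split; first exact: v.
rewrite derive1_g2; apply/vanishS; split; first exact: v.
by rewrite derive1_g3; apply/vanishS; split; first exact: v.
Qed.

Lemma shift_g0_P2C1 a : P2C1 (shift a (@g0 R)).
Proof.
have -> : shift a (@g0 R) = qtrig
    (- sin a * (3 - a ^+ 2) + 3 * a * cos a)
    (- 2 * a * sin a - 3 * cos a) (sin a)
    (cos a * (3 - a ^+ 2) + 3 * a * sin a)
    (2 * a * cos a - 3 * sin a) (- cos a); last exact: qtrig_P2C1.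
apply/funext => x; rewrite /shift /g0 /qtrig sinB cosB.
by move: (cos a) (sin a) (cos x) (sin x) => *; ring.
Qed.

Variable j : R.
Hypotheses (j0 : 0 < j) (j2pi : j < pi *+ 2) (gj : g0 j = 0).
Hypothesis g0_gt0 : forall x, 0 < x < j -> 0 < g0 x.

Lemma ext_chebyshev_measure_le I : ext_chebyshev I (@P2C1 R) ->
  (lebesgue_measure ([set` I] : set R) <= j%:E)%E.
Proof.
move=> [n [dimn _ count]]; rewrite leNgt; apply/negP => jI.
have [a aI ajI] := long_itv j0 jI.
have n6 : (n <= 6)%N := dim_on_le dimn.
have sg := @smooth_g0 R.
have : (zero_count I (shift a (@g0 R)) < n%:R%:E)%E.
  apply: count; first exact: shift_g0_P2C1.
  (* The translate is not identically 0 on [I]: it is positive halfway between its two zeros. *)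
  move=> /(_ (a + j / 2)).
  have -> : a + j / 2 \in I.
    apply: (itv_convex aI ajI).
    by rewrite lerDl lerD2l ler_pdivrMr// ler_peMr ?ltW ?divr_gt0// ltr1n.
  move=> /(_ isT); rewrite /shift addrC addKr => E.
  suff : 0 < g0 (j / 2) by rewrite E ltxx.
  apply: g0_gt0.
  by rewrite divr_gt0//= ltr_pdivrMr// ltr_pMr// ltr1n.
apply/negP; rewrite -leNgt.
apply: (@le_trans _ _ (5 + 1)%:R%:E); first by rewrite lee_fin ler_nat.
apply: (@zero_count_ge2 _ 5 1 I _ a (a + j)) => //.
- by rewrite lt_eqF// ltrDl.
- by rewrite -[X in vanish _ _ X]add0r; exact: vanish_shift vanish_g0.
- rewrite addrC; apply: vanish_shift => //.
  by case.
Qed.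

Lemma zero_list_P2C1 a0 a1 a2 b0 b1 b2 s : (6 <= size s)%N ->
  zero_list 0 j (@qtrig R a0 a1 a2 b0 b1 b2) s ->
  [/\ a0 = 0, a1 = 0, a2 = 0 & [/\ b0 = 0, b1 = 0 & b2 = 0]].
Proof.
apply: zero_list_qtrig => x xj.
- by rewrite gt_eqF// g0_gt0.
- by rewrite lt_eqF// m01_lt0//; case/andP: xj.
- apply: w3_neq0; last exact: g0_gt0.
  by case/andP: xj => x0 xj; rewrite x0 (lt_trans xj).
Qed.

Lemma ext_chebyshev_P2C1 : ext_chebyshev `]0, j[%R (@P2C1 R).
Proof.
exists 6; split.
- exists basis; split=> [c c0|f [c ->]|c]; last 2 first.
  + by exists c.
  + by exists (lincomb basis c) => //; exists c.
  rewrite lincomb_qtrig in c0.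
  (* Linear independence on ]0, j[: a combination vanishing there vanishes at these six distinct
     points. *)
  pose pt (k : nat) : R := j * (k.+1%:R / 7).
  pose s := mkseq pt 6.
  have us : uniq s.
    rewrite map_inj_uniq ?iota_uniq// => k l; rewrite /pt.
    move=> /(mulfI (lt0r_neq0 j0)) /(mulIf _) H.
    have /eqP := H ltac:(by rewrite invr_eq0 pnatr_eq0).
    by rewrite eqr_nat => /eqP[].
  have sj x : x \in s -> 0 < x < j.
    move=> /mapP[k]; rewrite mem_iota => /andP[_ k6] ->.
    rewrite /pt !mulr_gt0 ?divr_gt0//= gtr_pMr// ltr_pdivrMr// mul1r.
    by rewrite ltr_nat.
  have /zero_list_P2C1[|E0 E2 E4 [E1 E3 E5]] : zero_list 0 j (qtrig (c (inord 0))
      (c (inord 2)) (c (inord 4)) (c (inord 1)) (c (inord 3)) (c (inord 5))) s.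
    move=> x xs; split; first exact: sj.
    rewrite count_uniq_mem// xs => -[|//] _ /=.
    by apply: c0; rewrite in_itv /=; exact: sj.
  + by rewrite size_mkseq.
  move=> i; rewrite -[i]inord_val.
  by case: i => -[|[|[|[|[|[|]]]]]].
- move=> f /P2C1_qtrig[a0 [a1 [a2 [b0 [b1 [b2 ->]]]]]] k x _.
  exact: (smooth_upto (n := k.+1) (smooth_qtrig _ _ _ _ _ _)).
- move=> f /P2C1_qtrig[a0 [a1 [a2 [b0 [b1 [b2 ->]]]]]] f0.
  apply: zero_list_ltn_zero_count => s Z; rewrite ltnNge; apply/negP => s6.
  have [E0 E1 E2 [E3 E4 E5]] := zero_list_P2C1 s6 Z.
  by apply: f0 => x _; rewrite E0 E1 E2 E3 E4 E5 /qtrig !(mul0r, addr0).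
Qed.

Lemma critical_length_P2C1 : critical_length (@P2C1 R) = j%:E.
Proof.
apply/eqP; rewrite eq_le; apply/andP; split.
  by apply: ge_ereal_sup => _ [I [_ EI] <-]; exact: ext_chebyshev_measure_le.
apply: ereal_sup_ubound; exists `]0, j[%R.
  by split; [rewrite lebesgue_measure_itv /= lte_fin j0 oppr0 adde0 | exact: ext_chebyshev_P2C1].
by rewrite lebesgue_measure_itv /= lte_fin j0 oppr0 adde0.
Qed.

End CriticalLength.

(** * Euler's integral and its recurrence *)

Section GammaFunction.
Variable R : realType.
Implicit Types (p s t x : R).
Local Notation mu := (@lebesgue_measure R).

(** For an integer n >= p, the bound [expR t >= t ^ (n + 1) / (n + 1)!] dominates the function by
    [(n + 1)! / t]. *)
Lemma powR_expRN_cvg0 p : (t `^ p * expR (- t)) @[t --> +oo%R] --> (0 : R).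
Proof.
pose n := (Num.truncn `|p|).+1.
have pn : p <= n%:R by apply: le_trans (ler_norm p) (ltW _); exact: truncnS_gt.
apply: (@squeeze_cvgr _ _ _ _ (fun=> 0) (fun t => (n.+1)`!%:R * t^-1)).
- near=> t.
  have t1 : 1 <= t by near: t; exact: nbhs_pinfty_ge.
  have t0 : 0 < t by exact: lt_le_trans t1.
  rewrite mulr_ge0 ?powR_ge0 ?expR_ge0//=.
  rewrite expRN ler_pdivlMr// -mulrA [_^-1 * _]mulrC mulrA ler_pdivrMr ?expR_gt0//.
  rewrite -ler_pdivrMl ?ltr0n ?fact_gt0//.
  apply: (@le_trans _ _ (1 + t ^+ n.+1 / (n.+1)`!%:R)); last by apply: expR_ge1Dxn; exact: ltW.
  rewrite mulrC -[leLHS]add0r lerD// ler_pM2r ?invr_gt0 ?ltr0n ?fact_gt0//.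
  rewrite exprSr ler_pM2r// -powR_mulrn ?(ltW t0)//.
  exact: ler_powR.
- exact: cvg_cst.
- rewrite -[X in _ --> X](mulr0 (n.+1)`!%:R); apply: cvgM; first exact: cvg_cst.
  by apply/(@gtr0_cvgV0 _ _ _ _ id); [exact: nbhs_pinfty_gt | exact: cvg_id].
Unshelve. all: by end_near. Qed.

Lemma powR_cvg_right0 p : 0 <= p -> (t `^ p) @[t --> (0 : R)^'+] --> ((0 : R) `^ p).
Proof.
rewrite le_eqVlt => /predU1P[<-|p0].
  rewrite (_ : (fun t => t `^ 0) = fun=> 1); first by rewrite powRr0; exact: cvg_cst.
  by apply/funext => t; rewrite powRr0.
by rewrite powR0 ?gt_eqF//; exact: powR_cvg0.
Qed.

(** The integral for Gamma at p + 1, kept in the extended reals so that the recurrence can be proved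
    first and finiteness deduced from it. *)
Definition eulerI p := (\int[mu]_(t in `]0%R, +oo[) (t `^ p * expR (- t))%:E)%E.

Lemma measurable_powR_expRN (D : set R) p :
  measurable_fun D (fun t => t `^ p * expR (- t)).
Proof.
apply: measurable_funTS; apply: measurable_funM => //.
by apply: measurableT_comp => //; exact: measurable_oppr.
Qed.

Lemma powR_expRN_ge0 p t : (0 <= (t `^ p * expR (- t))%:E)%E.
Proof. by rewrite lee_fin mulr_ge0 ?powR_ge0 ?expR_ge0. Qed.

(* A constant multiple of [expR (- t)] is added to minus the derivative of
   [t `^ (p + 1) * expR (- t)] in order to make it nonnegative. *)
Definition euler_density p t : R :=
  expR (- t) * (t `^ (p + 1) - (p + 1) * t `^ p + (p + 1) `^ (p + 1)).

(** The bracket is [(t - (p + 1)) * t ^ p] plus the constant. The product is nonnegative from p + 1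
    on, and before that at least [- (p + 1) * (p + 1) ^ p]. *)
Lemma euler_density_ge0 p t : 0 <= p -> 0 <= t -> 0 <= euler_density p t.
Proof.
move=> p0 t0; have p1 : 0 < p + 1 by rewrite ltr_wpDl.
have powS u : 0 <= u -> u `^ (p + 1) = u * u `^ p.
  by move=> u0; rewrite -(mulr_powRB1 u0 p1) addrK.
rewrite /euler_density mulr_ge0 ?expR_ge0// powS// (powS _ (ltW p1)) -mulrBl.
have [pt|tp] := leP (p + 1) t.
  by rewrite addr_ge0// mulr_ge0 ?powR_ge0 ?subr_ge0// ltW.
have : t `^ p <= (p + 1) `^ p by apply: ge0_ler_powR; rewrite ?nnegrE// ltW.
have := powR_ge0 t p; move: (t `^ p) ((p + 1) `^ p) => u v u0 uv.
nra.
Qed.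

Lemma integral_euler_density p : 0 <= p ->
  (\int[mu]_(t in `]0%R, +oo[) (euler_density p t)%:E =
   ((p + 1) `^ (p + 1))%:E)%E.
Proof.
move=> p0; set K := (p + 1) `^ (p + 1); set f := euler_density p.
have p1 : 0 < p + 1 by rewrite ltr_wpDl.
have f0 t : 0 <= t -> 0 <= f t by exact: euler_density_ge0.
(* An antiderivative of [f], equal to [- K] at 0 and tending to 0 at infinity. *)
pose F t := - (t `^ (p + 1) * expR (- t) + K * expR (- t)).
have cexp t : expR (- x) @[x --> t] --> expR (- t).
  by apply: continuous_comp; [exact: opp_continuous | exact: continuous_expR].
have cf : {within `[0, +oo[, continuous f}.
  apply/continuous_within_itvcyP; split.
    move=> t; rewrite in_itv/= andbT => t0.
    have cp q : {for t, continuous (fun u => u `^ q)}.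
      apply/differentiable_continuous/derivable1_diffP.
      by apply: derivable_powR; rewrite in_itv/= andbT.
    apply: cvgM; first exact: cexp.
    apply: cvgD; last exact: cvg_cst.
    apply: cvgB; first exact: cp.
    by apply: cvgM; [exact: cvg_cst | exact: cp].
  apply: cvgM; first by apply: cvg_at_right_filter; exact: cexp.
  apply: cvgD; last exact: cvg_cst.
  apply: cvgB; first by apply: powR_cvg_right0; exact: ltW.
  by apply: cvgM; [exact: cvg_cst | exact: powR_cvg_right0].
have Foo : F x @[x --> +oo%R] --> (0 : R).
  rewrite -[X in _ --> X]oppr0; apply: cvgN; rewrite -[X in _ --> X](addr0 0).
  apply: cvgD; first exact: powR_expRN_cvg0.
  rewrite -[X in _ --> X](mulr0 K).
  by apply: cvgM; [exact: cvg_cst | exact: cvgr_expR].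
have dF t : 0 < t -> is_derive t 1 F (f t).
  move=> t0; have de : is_derive t 1 (fun u => expR (- u)) (- expR (- t)).
    apply: (is_derive_eq (@is_derive1_comp _ expR (fun u => - u) t _ _
      (is_derive_expR (- t)) (is_derive_opp (is_derive_var t)))).
    by rewrite mulrN1.
  have dp : is_derive t 1 (fun u => u `^ (p + 1)) ((p + 1) * t `^ p).
    by have := is_derive1_powR (p + 1) t0; rewrite addrK.
  apply: (is_derive_eq (is_derive_opp (is_derive_add (is_derive_mul dp de)
    (is_derive_mul (is_derive_const K t) de)))).
  by rewrite /f /euler_density -/K; ring.
have F0 : F 0 = - K.
  by rewrite /F powR0 ?gt_eqF// mul0r add0r oppr0 expR0 mulr1.
rewrite integral_itv_obnd_cbnd; last first.
  apply/measurable_EFinP; apply: open_continuous_measurable_fun => //.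
  by move: cf => /continuous_within_itvcyP[/in_continuous_mksetP].
rewrite (ge0_continuous_FTC2y f0 cf Foo) ?F0 ?EFinN ?oppeK ?add0e//.
- by move=> t /dF[].
- rewrite -F0 /F; apply: cvgN; apply: cvgD; apply: cvgM.
  + by apply: powR_cvg_right0; exact: ltW.
  + by apply: cvg_at_right_filter; exact: cexp.
  + exact: cvg_cst.
  + by apply: cvg_at_right_filter; exact: cexp.
- by move=> t; rewrite in_itv/= andbT => /dF dFt; rewrite derive1E; apply: derive_val.
Qed.

Lemma eulerI0 : eulerI 0 = 1%E.
Proof.
have cexp t : expR (- x) @[x --> t] --> expR (- t).
  by apply: continuous_comp; [exact: opp_continuous | exact: continuous_expR].
have dF t : is_derive t 1 (fun u => - expR (- u)) (expR (- t)).
  apply: (is_derive_eq (is_derive_opp (@is_derive1_comp _ expR (fun u => - u) t _ _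
    (is_derive_expR (- t)) (is_derive_opp (is_derive_var t))))).
  by rewrite mulrN1 opprK.
rewrite /eulerI integral_itv_obnd_cbnd;
  last by apply/measurable_EFinP; exact: measurable_powR_expRN.
have -> : (fun t : R => (t `^ 0 * expR (- t))%:E) = fun t => (expR (- t))%:E.
  by apply/funext => t; rewrite powRr0 mul1r.
rewrite (@ge0_continuous_FTC2y _ (fun t => expR (- t)) (fun t => - expR (- t)) 0 0).
- by rewrite oppr0 expR0 EFinN oppeK add0e.
- by move=> t _; exact: expR_ge0.
- exact: continuous_subspaceT.
- by rewrite -[X in _ --> X]oppr0; apply: cvgN; exact: cvgr_expR.
- by move=> t _; have [] := dF t.
- by apply: cvgN; apply: cvg_at_right_filter; exact: cexp.
- by move=> t _; rewrite derive1E; apply: derive_val.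
Qed.

Lemma eulerIZ (c p : R) : 0 <= c ->
  (c%:E * eulerI p = \int[mu]_(t in `]0%R, +oo[) (c * (t `^ p * expR (- t)))%:E)%E.
Proof.
move=> c0; rewrite /eulerI -ge0_integralZl_EFin//.
- by move=> t _; exact: powR_expRN_ge0.
- by apply/measurable_EFinP; exact: measurable_powR_expRN.
Qed.

Lemma eulerID (c p d q : R) : 0 <= c -> 0 <= d ->
  (c%:E * eulerI p + d%:E * eulerI q = \int[mu]_(t in `]0%R, +oo[)
    (c * (t `^ p * expR (- t)) + d * (t `^ q * expR (- t)))%:E)%E.
Proof.
have m (e r : R) : measurable_fun (`]0, +oo[ : set R)
    (EFin \o (fun t => e * (t `^ r * expR (- t)))).
  apply/measurable_EFinP; apply: measurable_funM; first exact: measurable_cst.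
  exact: measurable_powR_expRN.
move=> c0 d0; rewrite !eulerIZ// -ge0_integralD.
- by apply: eq_integral => t _; rewrite EFinD.
- exact: measurable_itv.
- by move=> t _; rewrite EFinM; apply: mule_ge0; [rewrite lee_fin|exact: powR_expRN_ge0].
- exact: m.
- by move=> t _; rewrite EFinM; apply: mule_ge0; [rewrite lee_fin|exact: powR_expRN_ge0].
- exact: m.
Qed.

Lemma measurable_euler_density (D : set R) p :
  measurable_fun D (EFin \o euler_density p).
Proof.
apply/measurable_EFinP; apply: measurable_funM.
  by apply/measurable_funTS/measurableT_comp => //; exact: measurable_oppr.
apply: measurable_funD; last exact: measurable_cst.
apply: measurable_funB; first by apply: measurable_funTS; exact: measurable_powR.
apply: measurable_funM; first exact: measurable_cst.
by apply: measurable_funTS; exact: measurable_powR.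
Qed.

(** Integration by parts with nonnegative integrands only: [K] is added to both sides, on the left
    as [K * eulerI 0] and on the right as the integral of [euler_density p]; the integrands then
    agree pointwise. *)
Lemma eulerIS p : 0 <= p -> (eulerI (p + 1) = (p + 1)%:E * eulerI p)%E.
Proof.
move=> p0; have p1 : 0 <= p + 1 by exact: addr_ge0.
set K := (p + 1) `^ (p + 1); have K0 : 0 <= K by exact: powR_ge0.
rewrite -[LHS](@addeK _ K%:E)// -[RHS](@addeK _ K%:E)//; congr (_ - _)%E.
rewrite addeC [RHS]addeC -[in RHS](integral_euler_density p0).
rewrite -[X in (X + _)%E]mule1 -eulerI0 -[eulerI (p + 1)]mul1e eulerID// eulerIZ//.
rewrite -ge0_integralD.
- apply: eq_integral => t _; rewrite -EFinD; congr EFin.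
  by rewrite /euler_density powRr0 -/K; ring.
- exact: measurable_itv.
- by move=> t; rewrite /= in_itv/= andbT lee_fin => /ltW; exact: euler_density_ge0.
- exact: measurable_euler_density.
- by move=> t _; rewrite EFinM; apply: mule_ge0; [rewrite lee_fin|exact: powR_expRN_ge0].
- apply/measurable_EFinP; apply: measurable_funM; first exact: measurable_cst.
  exact: measurable_powR_expRN.
Qed.

End GammaFunction.

(** * The Gamma function and the Bessel function of order 5/2 *)

Section GammaBessel.
Variable R : realType.
Implicit Types (p s t x : R).
Local Notation mu := (@lebesgue_measure R).

Lemma GammaE s : Gamma s = fine (eulerI (s - 1)).
Proof. by []. Qed.

Lemma GammaS s : 1 <= s -> Gamma (s + 1) = s * Gamma s.
Proof.
move=> s1; rewrite !GammaE (_ : s + 1 - 1 = s - 1 + 1); last by ring.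
rewrite eulerIS ?subr_ge0// subrK.
have : (0 <= eulerI (s - 1))%E by apply: integral_ge0 => t _; exact: powR_expRN_ge0.
(* If the integral were infinite, both sides would be 0, the default value of [fine]. *)
case: (eulerI _) => [r| |] //= _; rewrite ?mulr0// mulry gtr0_sg ?mul1e//.
exact: lt_le_trans s1.
Qed.

Lemma Gamma_nat k : Gamma (k%:R + 1) = k`!%:R :> R.
Proof.
elim: k => [|k IH]; first by rewrite add0r GammaE subrr eulerI0.
by rewrite -natr1 GammaS ?lerDr ?ler0n// IH natr1 factS natrM.
Qed.

(** Integer exponents follow from the recurrence, and [t ^ p <= 1 + t ^ n] for an integer n >= p
    gives the rest. *)
Lemma eulerI_lty p : 0 <= p -> (eulerI p < +oo)%E.
Proof.
move=> p0; pose n := (Num.truncn `|p|).+1.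
have pn : p <= n%:R by apply: le_trans (ler_norm p) (ltW _); exact: truncnS_gt.
have fin m : (eulerI (m%:R) < +oo :> \bar R)%E.
  elim: m => [|m IH]; first by rewrite eulerI0 ltry.
  by rewrite -natr1 eulerIS// lte_mul_pinfty// ?lee_fin.
apply: (@le_lt_trans _ _ (1%:E * eulerI 0 + 1%:E * eulerI n%:R)%E); last first.
  by rewrite !mul1e eulerI0 lte_add_pinfty ?ltry.
rewrite eulerID//; apply: ge0_le_integral => //.
- by move=> t _; exact: powR_expRN_ge0.
- by apply/measurable_EFinP; exact: measurable_powR_expRN.
- apply/measurable_EFinP; apply: measurable_funD; apply: measurable_funM;
    by [exact: measurable_cst | exact: measurable_powR_expRN].
- move=> t; rewrite /= in_itv/= andbT => t0; rewrite lee_fin !mul1r -mulrDl.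
  rewrite ler_pM2r ?expR_gt0// powRr0.
  have [t1|t1] := leP 1 t; first by rewrite ler_wpDl// ler_powR.
  rewrite ler_wpDr ?powR_ge0//; rewrite (_ : 1 = 1 `^ p); last by rewrite powR1.
  by apply: ge0_ler_powR; rewrite ?nnegrE// ltW.
Qed.

Lemma eulerI_gt0 p : 0 <= p -> (0 < eulerI p)%E.
Proof.
move=> p0.
apply: (@lt_le_trans _ _ (\int[mu]_(t in `[1%R, 2%R]) (expR (- 2))%:E)%E).
  rewrite integral_cst//= lebesgue_measure_itv/= lte_fin ltr1n.
  by rewrite -EFinB -EFinM lte_fin mulr_gt0 ?expR_gt0// subr_gt0 ltr1n.
apply: (@le_trans _ _ (\int[mu]_(t in `[1%R, 2%R]) (t `^ p * expR (- t))%:E)%E).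
  apply: ge0_le_integral.
  - exact: measurable_itv.
  - by move=> t _; rewrite lee_fin expR_ge0.
  - exact: measurable_cst.
  - by apply/measurable_EFinP; exact: measurable_powR_expRN.
  - move=> t; rewrite /= in_itv/= => /andP[t1 t2]; rewrite lee_fin.
    rewrite -[leLHS]mul1r ler_pM ?expR_ge0//; last by rewrite ler_expR lerN2.
    rewrite [leLHS](_ : 1 = 1 `^ p); last by rewrite powR1.
    by apply: ge0_ler_powR; rewrite ?nnegrE// (le_trans _ t1).
apply: ge0_subset_integral => //.
- by apply/measurable_EFinP; exact: measurable_powR_expRN.
- by move=> t _; exact: powR_expRN_ge0.
- by move=> t /=; rewrite !in_itv/= andbT => /andP[t1 _]; exact: lt_le_trans t1.
Qed.

Lemma Gamma_gt0 s : 1 <= s -> 0 < Gamma s.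
Proof.
by move=> s1; rewrite GammaE fine_gt0// eulerI_gt0 ?eulerI_lty ?subr_ge0.
Qed.

(** The rising factorial of 7/2; with it, Gamma at 7/2 remains a common factor that need not be
    evaluated. *)
Let r k : R := \prod_(i < k) (7 / 2 + i%:R).

Let r_gt0 k : 0 < r k.
Proof. by apply: prodr_gt0 => i _; rewrite ltr_pwDl// divr_gt0. Qed.

Let Gamma_half k : Gamma (k%:R + 5 / 2 + 1) = Gamma (7 / 2) * r k.
Proof.
elim: k => [|k IH].
  by rewrite /r big_ord0 mulr1; congr Gamma; field.
rewrite -natr1 (_ : k%:R + 1 + 5 / 2 = k%:R + 5 / 2 + 1); last by ring.
have k0 : 0 <= k%:R :> R by exact: ler0n.
rewrite GammaS; last by lra.
by rewrite IH /r big_ord_recr/=; field.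
Qed.

Let factE k : ((k.*2 + 5)`!)%:R =
  60 * (k%:R + 1) * (k%:R + 2) * 4 ^+ k * k`!%:R * r k :> R.
Proof.
elim: k => [|k IH]; first by rewrite /r big_ord0 add0n !factS fact0 !natrM /=; ring.
rewrite doubleS 2!addSn !factS !natrM IH /r big_ord_recr/= exprS.
rewrite -!natr1 natrD -mul2n natrM.
by field.
Qed.

(** The term of degree 2 k + 5 in the power series of [g0]; the index shifts align the three
    degrees. *)
Let a x k : R := 3 * sin_coeff' x k.+2 - x ^+ 2 * sin_coeff' x k.+1
  - 3 * x * cos_coeff' x k.+2.

Let series_a x n : series (a x) n = 3 * series (sin_coeff' x) n.+2
  - x ^+ 2 * series (sin_coeff' x) n.+1 - 3 * x * series (cos_coeff' x) n.+2.
Proof.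
have S (u : R^nat) k : series u k.+1 = series u k + u k by rewrite seriesSr.
elim: n => [|n IH].
  (* The terms of degree 1 and 3, left out of [a], cancel. *)
  rewrite /series /= !big_nat_recr//= !big_geq//= /sin_coeff' /cos_coeff' /=.
  rewrite -!exprnP !factS fact0 (_ : 1.*2 = 2)%N// (_ : 0.*2 = 0)%N//.
  by rewrite /=; field.
rewrite S IH (S _ n.+2) (S _ n.+1) (S (cos_coeff' x) n.+2) /a.
move: (series _ _) (series _ _) => u v.
by move: (sin_coeff' _ _) (sin_coeff' _ _) (cos_coeff' _ _) => *; ring.
Qed.

(** Over the common denominator (2 k + 5)! the numerator is [4 * (k + 1) * (k + 2)], which cancels
    against [factE]. *)
Let aE x k : a x k = (-1) ^+ k * x ^+ (k.*2 + 5) / (15 * 4 ^+ k * k`!%:R * r k).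
Proof.
rewrite /a /sin_coeff' /cos_coeff' -!exprnP !doubleS.
have n1 : (k.*2.+1)%:R = 2 * k%:R + 1 :> R by rewrite -addn1 natrD -mul2n natrM.
have n2 : (k.*2.+2)%:R = 2 * k%:R + 2 :> R by rewrite -addn2 natrD -mul2n natrM.
have n3 : (k.*2.+3)%:R = 2 * k%:R + 3 :> R by rewrite -addn3 natrD -mul2n natrM.
have n4 : (k.*2.+4)%:R = 2 * k%:R + 4 :> R by rewrite -addn4 natrD -mul2n natrM.
have n5 : (k.*2.+4.+1)%:R = 2 * k%:R + 5 :> R by rewrite -natr1 n4; ring.
have := factE k; rewrite !addnS addn0 !factS !natrM n1 n2 n3 n4 n5.
have : (k.*2`!)%:R != 0 :> R by rewrite pnatr_eq0 -lt0n fact_gt0.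
move: (k.*2`!%:R) => N N0.
have f0 : k`!%:R != 0 :> R by rewrite pnatr_eq0 -lt0n fact_gt0.
have r0 := lt0r_neq0 (r_gt0 k); have k0 : 0 <= k%:R :> R by exact: ler0n.
set D := 15 * 4 ^+ k * k`!%:R * r k => E.
have {}E : D = (2 * k%:R + 5) * ((2 * k%:R + 4) * ((2 * k%:R + 3) *
    ((2 * k%:R + 2) * ((2 * k%:R + 1) * N)))) / (4 * (k%:R + 1) * (k%:R + 2)).
  rewrite E /D; field.
  by rewrite !gt_eqF//; lra.
rewrite E !exprS; move: (k%:R) k0 (x ^+ k.*2) ((-1) ^+ k) {E D f0 r0 n1 n2 n3 n4 n5} => K K0 X e.
field.
rewrite N0 !gt_eqF//; lra.
Qed.

(** The two power series agree term by term up to [C], which depends on [x] as [x ^ (- 5 / 2)].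
    Being nonzero, it does not affect the positive zeros. *)
Lemma besselJ_g0 x : 0 < x -> exists2 C, C != 0 & besselJ (5 / 2) x = C * g0 x.
Proof.
(* Determined by the terms with k = 0, where [a x 0 = x ^ 5 / 15]. *)
move=> x0; pose C := 15 * (x / 2) `^ (5 / 2) / (Gamma (7 / 2) * x ^+ 5).
have G0 : 0 < Gamma (7 / 2 : R) by apply: Gamma_gt0; lra.
have C0 : 0 < C by rewrite divr_gt0// mulr_gt0 ?powR_gt0 ?divr_gt0// exprn_gt0.
exists C; first exact: lt0r_neq0.
apply: cvg_lim => //.
rewrite (_ : (fun k : nat => _) = fun k => C * a x k); last first.
  apply/funext => k; rewrite aE Gamma_nat Gamma_half.
  rewrite powRD; last by rewrite lt0r_neq0 ?divr_gt0// implybT.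
  rewrite -natrM powR_mulrn ?divr_ge0 ?(ltW x0)// mul2n.
  have f0 : k`!%:R != 0 :> R by rewrite pnatr_eq0 -lt0n fact_gt0.
  have r0 := lt0r_neq0 (r_gt0 k); have g0 := lt0r_neq0 G0.
  have xn0 := lt0r_neq0 x0.
  rewrite /C exprD -muln2 mulnC !exprM expr_div_n (_ : 2 ^+ 2 = 4); last by ring.
  have p40 : 4 ^+ k != 0 :> R by rewrite expf_neq0// pnatr_eq0.
  rewrite expr_div_n; move: (4 ^+ k) p40 => p4 p40.
  move: ((x ^+ 2) ^+ k) ((-1) ^+ k) (_ `^ _) => X e y.
  by field; rewrite f0 r0 p40 xn0.
rewrite (_ : series _ = fun n => C * (3 * series (sin_coeff' x) n.+2
  - x ^+ 2 * series (sin_coeff' x) n.+1 - 3 * x * series (cos_coeff' x) n.+2)).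
  rewrite (_ : g0 x = 3 * sin x - x ^+ 2 * sin x - 3 * x * cos x); last first.
    by rewrite /g0 /qtrig; ring.
  have cs := @cvg_sin_coeff' R x; have cc := @cvg_cos_coeff' R x.
  apply: cvgM; first exact: cvg_cst.
  apply: cvgB; [apply: cvgB|]; apply: cvgM; do ?[exact: cvg_cst].
  - by rewrite (cvg_shiftS (fun n => series (sin_coeff' x) n.+1)) cvg_shiftS.
  - by rewrite cvg_shiftS.
  - by rewrite (cvg_shiftS (fun n => series (cos_coeff' x) n.+1)) cvg_shiftS.
by apply/funext => n; rewrite -series_a /series /= mulr_sumr.
Qed.

End GammaBessel.

Theorem mainTheorem2 (R : realType) :
  exists j : R,
    first_pos_zero (besselJ (5 / 2)) j /\
    critical_length (@P2C1 R) = j%:E.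
Proof.
have [j [j0 j2pi gj g_gt0]] := g0_first_zero R.
exists j; split; last exact: critical_length_P2C1.
split=> // [|x x0 xj].
  by have [C _ ->] := besselJ_g0 j0; rewrite gj mulr0.
have [C C0 ->] := besselJ_g0 x0; apply/eqP.
by rewrite mulf_neq0// gt_eqF// g_gt0// x0.
Qed.
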